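(* Let $F(z)=\sum_{k=0}^\infty b_k z^k\in\mathcal{B}$ and let \[ R=\frac{1}{4\sqrt3}\sqrt{59-\sqrt{2713}}. \] Then for all $r$ with $R\le r\le 1/\sqrt3$, \[ (1-|b_1|^2)\sum_{k=1}^\infty k|b_k|^2r^{2k}\le \frac{27}{8}r^4. \] The inequality is sharp: equality holds for $F(z)=\frac{3\sqrt3}{4}z^2$.
   Context: $\mathbb{D}$ denotes the open unit disc. $\mathcal{B}$ is the class of functions $F$ analytic in $\mathbb{D}$ satisfying $|F'(z)|\le \frac{1}{1-|z|^2}$ for all $z\in\mathbb{D}$. For $F\in\mathcal{B}$ we write its Taylor expansion as $F(z)=\sum_{k=0}^\infty b_k z^k$. *)

(* Defs.v *)
From Stdlib Require Import Reals Lra.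
Open Scope R_scope.

Definition Cx := (R * R)%type.
Definition Cadd (z w : Cx) : Cx := (fst z + fst w, snd z + snd w).
Definition Cmul (z w : Cx) : Cx :=
  (fst z * fst w - snd z * snd w, fst z * snd w + snd z * fst w).
Definition Cscale (a : R) (z : Cx) : Cx := (a * fst z, a * snd z).
Definition Cnorm (z : Cx) : R := sqrt (fst z ^ 2 + snd z ^ 2).
Fixpoint Cpow (z : Cx) (n : nat) : Cx :=
  match n with O => (1, 0) | S m => Cmul z (Cpow z m) end.

Definition Cseries_cv (f : nat -> Cx) (l : Cx) : Prop :=
  Un_cv (fun n => sum_f_R0 (fun k => fst (f k)) n) (fst l) /\
  Un_cv (fun n => sum_f_R0 (fun k => snd (f k)) n) (snd l).

Definition ps_terms (b : nat -> Cx) (z : Cx) : nat -> Cx :=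
  fun k => Cmul (b k) (Cpow z k).

Definition deriv_terms (b : nat -> Cx) (z : Cx) : nat -> Cx :=
  fun k => Cscale (INR (S k)) (Cmul (b (S k)) (Cpow z k)).

(* F(z) = sum b_k z^k is analytic in the unit disc D (its Taylor series
   converges on D), and |F'(z)| <= 1/(1-|z|^2) on D. *)
Definition in_Bloch (b : nat -> Cx) : Prop :=
  (forall z : Cx, Cnorm z < 1 -> exists w, Cseries_cv (ps_terms b z) w) /\
  (forall z : Cx, Cnorm z < 1 ->
     exists w, Cseries_cv (deriv_terms b z) w /\ Cnorm w <= 1 / (1 - Cnorm z ^ 2)).

Definition R_low : R := / (4 * sqrt 3) * sqrt (59 - sqrt 2713).

Definition b_ext (k : nat) : Cx :=
  match k with 2%nat => (3 * sqrt 3 / 4, 0) | _ => (0, 0) end.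

(* Main.v *)
Require Import Defs.
From Stdlib Require Import Reals.
From Stdlib Require Import Lra Lia Psatz List.
From Coquelicot Require Import Coquelicot.
Import ListNotations.
Open Scope R_scope.

(** Write [f(z) = (2/3) F'(z / sqrt 3) = sum c_k z^k] and [t = 3 r^2]. The Bloch
    condition becomes [|f(z)| <= 2 / (3 - |z|^2)] on [|z| < sqrt 3] and the claim
    becomes [(1 - 9|c_0|^2/4) sum |c_k|^2 t^(k-1) / (k+1) <= 1/2] for [t0 <= t <= 1],
    where [t0 = 3 R^2] is a root of [8 t^2 - 59 t + 24]. Each summand is convex in
    [t], so only [t = t0] and [t = 1] matter; [t = 1] follows from Parseval's
    identity and [|c_1| <= 1 - |c_0|^2].

    At [t0] the inequality is an equality to first order in [A = |c_0|^2], so the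
    first-order behaviour of [c_1] and [c_2] has to be exact. It comes from the
    non-centred closed curve [z = v (1 - 2 m nu v)], [|v| = 1], with [nu = |c_0| / 3]
    and [m = 1 - A / 6]: there [|m + nu v|^2 <= (3 - |z|^2) / 2], so that
    [h(v) = f(z) (m + nu v)^2] has modulus at most [1]. Parseval's identity for
    [h(v) (1 + x v)], for every complex [x], bounds the first three coefficients of
    [h], hence [c_1] and [c_2]. The coefficients [c_k], [k >= 3], are of order [A] by
    Parseval's identity for [f(v) (1 + x v^(k-1))] on the unit circle. *)

(** * Parseval's identity for polynomials on the unit circle *)

Definition cis (x : R) : C := (cos x, sin x).

Fixpoint peval (l : list C) (v : C) : C :=
  match l with nil => (RtoC 0) | c :: l' => (c + v * peval l' v)%C end.

Fixpoint norm2 (l : list C) : R :=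
  match l with nil => 0 | c :: l' => Cmod c ^ 2 + norm2 l' end.

Lemma norm2_ge0 l : 0 <= norm2 l.
Proof. induction l as [|c l IH]; simpl; [lra|]. pose proof (pow2_ge_0 (Cmod c)). simpl in *; lra. Qed.

Lemma Cmod_sqr (z : C) : Cmod z ^ 2 = fst z ^ 2 + snd z ^ 2.
Proof. exact (Cmod2_alt z). Qed.

Lemma Cmod_cis x : Cmod (cis x) = 1.
Proof.
  transitivity (sqrt 1); [|apply sqrt_1]. unfold Cmod, cis; simpl. f_equal.
  pose proof (sin2_cos2 x) as H; unfold Rsqr in H; lra.
Qed.

Lemma cis_pow m x : (cis x ^ m)%C = cis (INR m * x).
Proof.
  induction m as [|m IH].
  - simpl. unfold cis. rewrite Rmult_0_l, cos_0, sin_0. reflexivity.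
  - rewrite Cpow_S, IH, S_INR. unfold cis, Cmult; simpl.
    replace ((INR m + 1) * x) with (x + INR m * x) by ring.
    rewrite cos_plus, sin_plus. f_equal; ring.
Qed.

Lemma is_RInt_value (f : R -> R) (a b l l' : R) :
  is_RInt f a b l -> l = l' -> is_RInt f a b l'.
Proof. intros H <-; exact H. Qed.

Lemma is_RInt_ext_R (f g : R -> R) a b l :
  (forall x : R, f x = g x) -> is_RInt f a b l -> is_RInt g a b l.
Proof. intros H; apply is_RInt_ext; intros x _; apply H. Qed.

Lemma is_RInt_cis_pow m (c : C) :
  is_RInt (fun x => Re (c * cis x ^ S m)) 0 (2 * PI) 0.
Proof.
  set (k := INR (S m)).
  assert (Hk : k <> 0) by (apply not_0_INR; lia).
  set (F := fun x => (fst c * sin (k * x) + snd c * cos (k * x)) / k).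
  apply is_RInt_value with (minus (F (2 * PI)) (F 0)).
  - apply (is_RInt_ext_R (fun x => fst c * cos (k * x) - snd c * sin (k * x))).
    { intros x. rewrite cis_pow. unfold cis, Re, Cmult; simpl. reflexivity. }
    apply (is_RInt_derive F).
    + intros x _. unfold F. auto_derive; [exact I|]. field; exact Hk.
    + intros x _. apply continuity_pt_filterlim. reg.
  - unfold F, minus, plus, opp; simpl.
    assert (Hp : forall g : R -> R, (forall y n, g (y + 2 * INR n * PI) = g y) ->
              g (k * (2 * PI)) = g (k * 0)).
    { intros g Hg. rewrite <- (Hg (k * 0) (S m)). f_equal. fold k. ring. }
    rewrite (Hp sin (fun y n => sin_period y n)), (Hp cos (fun y n => cos_period y n)).
    ring.
Qed.

(** Every monomial of the integrand has a positive exponent, so it integrates to zero over a period.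
    This kills the cross terms in [parseval]. *)
Lemma is_RInt_cis_pow_peval m (c : C) l :
  is_RInt (fun x => Re (c * cis x ^ S m * peval l (cis x))) 0 (2 * PI) 0.
Proof.
  revert m c; induction l as [|d l IH]; intros m c.
  - apply (is_RInt_ext_R (fun _ => 0)).
    + intros x. simpl peval. rewrite Cmult_0_r. reflexivity.
    + eapply is_RInt_value; [apply (is_RInt_const (V := R_NormedModule))|].
      apply Rmult_0_r.
  - apply (is_RInt_ext_R (fun x => plus (Re (c * d * cis x ^ S m))
                 (Re (c * cis x ^ S (S m) * peval l (cis x))))).
    + intros x. change plus with Rplus. simpl peval.
      rewrite (Cpow_S (cis x) (S m)).
      generalize (cis x ^ S m)%C (cis x) (peval l (cis x)). intros u v w.
      destruct u, v, w, c, d; unfold Re, Cmult, Cplus; simpl; ring.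
    + eapply is_RInt_value.
      * apply (is_RInt_plus (V := R_NormedModule)); [apply is_RInt_cis_pow | apply IH].
      * apply Rplus_0_r.
Qed.

(** Induction along the Horner form: on the unit circle |c + v p|^2 = |c|^2 + |p|^2 + 2 Re (conj(c)
    v p), and the last term has integral zero. *)
Lemma parseval l :
  is_RInt (fun x => Cmod (peval l (cis x)) ^ 2) 0 (2 * PI) (2 * PI * norm2 l).
Proof.
  induction l as [|c l IH].
  - simpl norm2. apply (is_RInt_ext_R (fun _ => 0)).
    + intros x. simpl peval. rewrite Cmod_0. ring.
    + eapply is_RInt_value; [apply (is_RInt_const (V := R_NormedModule))|].
      exact (eq_trans (Rmult_0_r _) (eq_sym (Rmult_0_r _))).
  - apply (is_RInt_ext_R (fun x => plus (plus (Cmod c ^ 2) (Cmod (peval l (cis x)) ^ 2))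
                 (Re ((2 * Cconj c) * cis x ^ 1 * peval l (cis x))))).
    + intros x. change plus with Rplus. simpl peval.
      assert (H : Cmod (cis x) ^ 2 = 1) by (rewrite Cmod_cis; ring).
      revert H. rewrite !Cmod_sqr, Cpow_1_r.
      generalize (cis x) (peval l (cis x)). intros [u1 u2] [v1 v2].
      destruct c as [c1 c2]; unfold Re, Cmult, Cplus, Cconj, RtoC; cbn [fst snd]; intro H.
      transitivity (c1 ^ 2 + c2 ^ 2 + (u1 ^ 2 + u2 ^ 2) * (v1 ^ 2 + v2 ^ 2)
         + 2 * (c1 * (u1 * v1 - u2 * v2) + c2 * (u1 * v2 + u2 * v1))); [rewrite H|]; ring.
    + eapply is_RInt_value.
      * apply (is_RInt_plus (V := R_NormedModule)); [|apply is_RInt_cis_pow_peval].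
        apply (is_RInt_plus (V := R_NormedModule)); [|exact IH].
        apply (is_RInt_const (V := R_NormedModule)).
      * cbn [norm2].
        transitivity ((2 * PI - 0) * Cmod c ^ 2 + 2 * PI * norm2 l + 0); [reflexivity | ring].
Qed.

(** The pointwise inequality is squared and integrated over the circle; Parseval turns both
    integrals into coefficient sums. *)
Lemma norm2_le l l' M :
  (forall v, Cmod v = 1 -> Cmod (peval l v) <= M * Cmod (peval l' v)) ->
  norm2 l <= M ^ 2 * norm2 l'.
Proof.
  intros H.
  assert (Hpi := PI_RGT_0).
  apply Rmult_le_reg_l with (2 * PI); [lra|].
  replace (2 * PI * (M ^ 2 * norm2 l')) with (scal (M ^ 2) (2 * PI * norm2 l'))
    by (unfold scal; simpl; unfold mult; simpl; ring).
  refine (is_RInt_le _ _ 0 (2 * PI) _ _ _ (parseval l)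
            (is_RInt_scal (V := R_NormedModule) _ _ _ _ _ (parseval l')) _); [lra|].
  intros x _.
  apply Rle_trans with ((M * Cmod (peval l' (cis x))) ^ 2); [|rewrite Rpow_mult_distr; apply Rle_refl].
  apply pow_incr. split; [apply Cmod_ge_0|].
  apply H, Cmod_cis.
Qed.

Fixpoint padd (l l' : list C) : list C :=
  match l, l' with
  | nil, _ => l'
  | _, nil => l
  | c :: t, d :: t' => (c + d)%C :: padd t t'
  end.

Definition pscal (x : C) (l : list C) : list C := map (Cmult x) l.

Lemma peval_padd l l' v : peval (padd l l') v = (peval l v + peval l' v)%C.
Proof.
  revert l'; induction l as [|c l IH]; intros [|d l']; simpl; try ring.
  rewrite IH; ring.
Qed.

Lemma peval_pscal x l v : peval (pscal x l) v = (x * peval l v)%C.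
Proof. induction l as [|c l IH]; simpl; [|rewrite IH]; ring. Qed.

Lemma peval_app l l' v :
  peval (l ++ l') v = (peval l v + v ^ length l * peval l' v)%C.
Proof.
  induction l as [|c l IH]; [simpl; ring|].
  cbn [app peval length]. rewrite IH, Cpow_S. ring.
Qed.

Lemma peval_repeat0 n v : peval (repeat (RtoC 0) n) v = (RtoC 0).
Proof. induction n as [|n IH]; simpl; [|rewrite IH]; ring. Qed.

Lemma norm2_app l l' : norm2 (l ++ l') = norm2 l + norm2 l'.
Proof. induction l as [|c l IH]; cbn [app norm2]; [|rewrite IH]; ring. Qed.

Lemma norm2_repeat0 n : norm2 (repeat (RtoC 0) n) = 0.
Proof. induction n as [|n IH]; cbn [repeat norm2]; [|rewrite IH, Cmod_0]; ring. Qed.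

Lemma norm2_padd_shift h r s :
  norm2 (padd (h ++ r) (repeat (RtoC 0) (length h) ++ s)) = norm2 h + norm2 (padd r s).
Proof.
  induction h as [|c h IH]; [simpl; ring|].
  cbn [length repeat app padd norm2]. rewrite IH, Cplus_0_r. ring.
Qed.

(* The left-hand side is the norm of the product with [1 + x v^n], n = length h. *)
Lemma bessel_two_term h r x M :
  (0 < length h)%nat ->
  (forall v, Cmod v = 1 -> Cmod (peval (h ++ r) v) <= M) ->
  norm2 h + norm2 (padd r (pscal x (h ++ r))) <= M ^ 2 * (1 + Cmod x ^ 2).
Proof.
  intros Hh H.
  (* From here on [length h] is n - 1, so 1, then [length h] zeros, then x is the coefficient list
     of 1 + x v^n. *)
  destruct h as [|c h]; [simpl in Hh; lia|]. set (h0 := c :: h) in *.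
  rewrite <- norm2_padd_shift.
  assert (E : norm2 ((RtoC 1) :: repeat (RtoC 0) (length h) ++ [x]) = 1 + Cmod x ^ 2).
  { cbn [norm2]. rewrite norm2_app, norm2_repeat0. cbn [norm2].
    rewrite Cmod_1. ring. }
  rewrite <- E. apply norm2_le. intros v Hv.
  replace (peval (padd _ _) v) with
    (peval (h0 ++ r) v * peval ((RtoC 1) :: repeat (RtoC 0) (length h) ++ [x]) v)%C.
  - rewrite Cmod_mult. apply Rmult_le_compat_r; [apply Cmod_ge_0 | auto].
  - rewrite peval_padd, (peval_app (repeat _ _)), peval_repeat0, peval_pscal.
    cbn [peval]. rewrite (peval_app (repeat _ _)), peval_repeat0.
    rewrite !repeat_length. cbn [peval length]. unfold h0 at 3; cbn [length].
    rewrite Cpow_S. ring.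
Qed.

(** * Uniform truncation of the Taylor series *)

Definition trunc (c : nat -> C) (n : nat) : list C := map c (seq 0 (S n)).

(** The Bloch condition after rescaling; the bound is 2/3 at the origin and 1 on the unit circle. *)
Definition disc_bounded (c : nat -> C) : Prop :=
  forall z : C, Cmod z < sqrt 3 ->
    exists w : C, Cseries_cv (fun k => (c k * z ^ k)%C) w /\
                  Cmod w <= 2 / (3 - Cmod z ^ 2).

Lemma trunc_S c n : trunc c (S n) = trunc c n ++ [c (S n)].
Proof. unfold trunc. rewrite (seq_S (S n)), map_app. reflexivity. Qed.

Lemma length_trunc c n : length (trunc c n) = S n.
Proof. unfold trunc. rewrite length_map, length_seq. reflexivity. Qed.

Lemma peval_trunc_S c n z :
  peval (trunc c (S n)) z = (peval (trunc c n) z + c (S n) * z ^ S n)%C.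
Proof.
  rewrite trunc_S, peval_app, length_trunc. cbn [peval]. ring.
Qed.

Lemma peval_trunc c n z :
  peval (trunc c n) z =
  (sum_f_R0 (fun k => fst (c k * z ^ k)%C) n, sum_f_R0 (fun k => snd (c k * z ^ k)%C) n).
Proof.
  induction n as [|n IH].
  - cbn [trunc seq map peval sum_f_R0]. rewrite <- surjective_pairing. simpl Cpow. ring.
  - rewrite peval_trunc_S, IH. reflexivity.
Qed.

Lemma Cmod_le_abs (z : C) : Cmod z <= Rabs (fst z) + Rabs (snd z).
Proof.
  apply Rsqr_incr_0_var; [|pose proof (Rabs_pos (fst z)); pose proof (Rabs_pos (snd z)); lra].
  rewrite !Rsqr_pow2, Cmod_sqr, <- (pow2_abs (fst z)), <- (pow2_abs (snd z)).
  pose proof (Rabs_pos (fst z)); pose proof (Rabs_pos (snd z)); nra.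
Qed.

Lemma Un_cv_terms_bounded u l :
  Un_cv (sum_f_R0 u) l -> exists M, forall k, Rabs (u k) <= M.
Proof.
  intros H.
  destruct (maj_by_pos _ (exist _ l H)) as [M [HM Hb]].
  exists (M + M). intros [|k].
  - specialize (Hb O). simpl in Hb. lra.
  - replace (u (S k)) with (sum_f_R0 u (S k) - sum_f_R0 u k) by (simpl; ring).
    eapply Rle_trans; [apply Rabs_triang|]. rewrite Rabs_Ropp.
    apply Rplus_le_compat; apply Hb.
Qed.

(** The terms of degrees n + 1 to n + j are dominated by a finite geometric sum, kept in closed form
    so that the induction on j telescopes. *)
Lemma trunc_tail c z x M n j :
  0 <= x < 1 -> (forall k, Cmod (c k * z ^ k)%C <= M * x ^ k) ->
  Cmod (peval (trunc c n) z) <=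
  Cmod (peval (trunc c (n + j)) z) + M * (x ^ S n - x ^ S (n + j)) / (1 - x).
Proof.
  intros Hx Hk. induction j as [|j IH].
  - rewrite Nat.add_0_r. replace (M * _ / _) with 0 by (field; lra). lra.
  - eapply Rle_trans; [exact IH|]. rewrite Nat.add_succ_r.
    set (m := (n + j)%nat). rewrite (peval_trunc_S c m).
    set (u := peval (trunc c m) z). set (v := (c (S m) * z ^ S m)%C).
    assert (Cmod u <= Cmod (u + v) + Cmod v).
    { replace u with ((u + v) + - v)%C at 1 by ring.
      eapply Rle_trans; [apply Cmod_triangle|]. rewrite Cmod_opp. lra. }
    pose proof (Hk (S m)) as Hm. fold v in Hm.
    replace (M * (x ^ S n - x ^ S (S m)) / (1 - x)) with
      (M * (x ^ S n - x ^ S m) / (1 - x) + M * x ^ S m) by (simpl; field; lra).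
    lra.
Qed.

(** A single n serves the whole disc of radius rho: boundedness of |c_k| r^k at an intermediate
    radius r makes the tails geometric with ratio rho / r, uniformly in z. Parseval's identity is
    then needed for polynomials only. *)
Lemma trunc_bound c rho eps K :
  disc_bounded c -> 0 <= rho < sqrt 3 -> 0 < eps ->
  exists n, (K <= n)%nat /\
    forall z, Cmod z <= rho -> Cmod (peval (trunc c n) z) <= 2 / (3 - Cmod z ^ 2) + eps.
Proof.
  intros Hc Hr He.
  set (r := (rho + sqrt 3) / 2).
  assert (Hrr : rho < r < sqrt 3) by (unfold r; lra).
  set (x := rho / r).
  assert (Hx : 0 <= x < 1).
  { unfold x. split; [apply Rdiv_le_0_compat; lra|].
    apply Rmult_lt_reg_r with r; [lra|]. unfold Rdiv. rewrite Rmult_assoc, Rinv_l; lra. }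
  assert (HM : exists M, 0 < M /\ forall k, Cmod (c k) * r ^ k <= M).
  { destruct (Hc (RtoC r)) as [w [[H1 H2] _]].
    { rewrite Cmod_R, Rabs_pos_eq; lra. }
    destruct (Un_cv_terms_bounded _ _ H1) as [M1 HM1].
    destruct (Un_cv_terms_bounded _ _ H2) as [M2 HM2].
    exists (Rmax 1 (M1 + M2)). split.
    - apply Rlt_le_trans with 1; [lra | apply Rmax_l].
    - intros k. eapply Rle_trans; [|apply Rmax_r].
      replace (Cmod (c k) * r ^ k) with (Cmod (c k * RtoC r ^ k)%C).
      + eapply Rle_trans; [apply Cmod_le_abs|]. apply Rplus_le_compat; auto.
      + rewrite Cmod_mult, Cmod_pow, Cmod_R, Rabs_pos_eq; [reflexivity | lra]. }
  destruct HM as [M [HM0 HM]].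
  destruct (pow_lt_1_zero x) with (y := eps / 2 * (1 - x) / M) as [N HN].
  { rewrite Rabs_pos_eq; lra. }
  { apply Rdiv_lt_0_compat; [|lra]. apply Rmult_lt_0_compat; lra. }
  exists (Nat.max K N). split; [lia|]. intros z Hz.
  set (n := Nat.max K N).
  assert (Hk : forall k, Cmod (c k * z ^ k)%C <= M * x ^ k).
  { intros k. rewrite Cmod_mult, Cmod_pow.
    apply Rle_trans with (Cmod (c k) * rho ^ k).
    - apply Rmult_le_compat_l; [apply Cmod_ge_0|].
      apply pow_incr. split; [apply Cmod_ge_0 | exact Hz].
    - replace (rho ^ k) with (r ^ k * x ^ k).
      + rewrite <- Rmult_assoc. apply Rmult_le_compat_r; [apply pow_le; lra | apply HM].
      + rewrite <- Rpow_mult_distr. f_equal. unfold x. field. lra. }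
  destruct (Hc z ltac:(lra)) as [w [[H1 H2] Hw]].
  destruct (H1 (eps / 4)) as [N1 HN1]; [lra|].
  destruct (H2 (eps / 4)) as [N2 HN2]; [lra|].
  (* Only j depends on z: it reaches far enough for pointwise convergence at z, whereas n was fixed
     beforehand. *)
  set (j := (N1 + N2)%nat).
  specialize (HN1 (n + j)%nat ltac:(unfold j; lia)).
  specialize (HN2 (n + j)%nat ltac:(unfold j; lia)).
  unfold Rdist in HN1, HN2.
  pose proof (trunc_tail c z x M n j Hx Hk) as Ht.
  assert (Htail : M * (x ^ S n - x ^ S (n + j)) / (1 - x) <= eps / 2).
  { specialize (HN (S n) ltac:(unfold n; lia)).
    rewrite Rabs_pos_eq in HN by (apply pow_le; lra).
    assert (0 <= x ^ S (n + j)) by (apply pow_le; lra).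
    apply Rle_trans with (M * (eps / 2 * (1 - x) / M) / (1 - x)); [|right; field; lra].
    unfold Rdiv at 1 3. apply Rmult_le_compat_r; [apply Rlt_le, Rinv_0_lt_compat; lra|].
    apply Rmult_le_compat_l; lra. }
  assert (Hlim : Cmod (peval (trunc c (n + j)) z) <= Cmod w + eps / 2).
  { rewrite peval_trunc. set (s := (_, _) : C).
    replace s with (w + (s - w))%C by ring.
    eapply Rle_trans; [apply Cmod_triangle|]. apply Rplus_le_compat_l.
    eapply Rle_trans; [apply Cmod_le_abs|].
    change (Rabs (fst s - fst w) + Rabs (snd s - snd w) <= eps / 2).
    unfold s; cbn [fst snd]. lra. }
  lra.
Qed.

(** * Polynomial inequalities *)

Definition t0 : R := (59 - sqrt 2713) / 16.

Lemma t0_bounds : 432 / 1000 < t0 < 4321 / 10000.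
Proof.
  unfold t0.
  assert (52.0864 < sqrt 2713 < 52.088); [|lra].
  split.
  - rewrite <- (sqrt_Rsqr 52.0864) by lra. apply sqrt_lt_1; unfold Rsqr; lra.
  - rewrite <- (sqrt_Rsqr 52.088) by lra. apply sqrt_lt_1; unfold Rsqr; lra.
Qed.

(** Equivalent to 1/t0 + t0/3 = 4/3 + 9/8, which is exactly the cancellation of the first-order
    terms in A at [t0]. *)
Lemma t0_inv : / t0 = (59 - 8 * t0) / 24.
Proof.
  pose proof t0_bounds.
  assert (8 * t0 ^ 2 - 59 * t0 + 24 = 0).
  { unfold t0. pose proof (sqrt_sqrt 2713 ltac:(lra)). nra. }
  apply Rmult_eq_reg_l with t0; [|lra]. rewrite Rinv_r by lra. nra.
Qed.

(** Here d is the slack in the Schwarz-Pick inequality w1 <= 1 - w0^2 for the function h, with w0^2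
    = A m^4 and w1 = m^2 g + 2 A m / 3. The bound is (1 - A)(1 - A/3) - d; since m^2 <= 1, dividing
    by m^2 keeps all of the slack. *)
Lemma first_coef_le A g :
  0 <= A <= 4 / 9 ->
  let m := 1 - A / 6 in
  let d := 1 - A * m ^ 4 - (m ^ 2 * g + 2 * A * m / 3) in
  0 <= d ->
  g <= 1 - 4 * A / 3 + A ^ 2 / 3 - d.
Proof.
  intros HA m d Hd.
  assert (Hm : 25/27 <= m <= 1) by (unfold m; lra).
  assert (Hm2 : 0 < m ^ 2) by nra.
  apply Rmult_le_reg_l with (m ^ 2); [exact Hm2|].
  replace (m ^ 2 * g) with (1 - A * m ^ 4 - 2 * A * m / 3 - d) by (unfold d; field).
  assert (Hm1 : m ^ 2 <= 1) by nra.
  assert (m ^ 2 * d <= d) by (apply Rle_trans with (1 * d); [apply Rmult_le_compat_r|]; lra).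
  assert (1 - A * m ^ 4 - 2 * A * m / 3 <= m ^ 2 * (1 - 4 * A / 3 + A ^ 2 / 3)); [|nra].
  apply Rminus_le_0.
  replace (_ - _) with (A ^ 2 * (1 / 36 + A / 54 - A ^ 2 / 108 + A ^ 3 / 1296)) by (unfold m; field).
  apply Rmult_le_pos; [nra|]. assert (0 <= A ^ 3) by (apply pow_le; lra). nra.
Qed.

(** Here q stands for |c_1|^2, and all the mass left by Parseval is charged at the weight t0/3 of
    c_2. This loses at first order in A, which is harmless once A is bounded away from 0. *)
Lemma crude_large A q :
  6 / 100 <= A <= 4 / 9 -> 0 <= q <= (1 - 4 * A / 3 + A ^ 2 / 3) ^ 2 ->
  (1 - 9 * A / 4) * (A / t0 + q / 2 + t0 / 3 * (1 - A - q)) <= 1 / 2.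
Proof.
  intros HA Hq. pose proof t0_bounds as Ht.
  replace (A / t0) with (A * ((59 - 8 * t0) / 24)) by (rewrite <- t0_inv; reflexivity).
  set (Q := (1 - 4 * A / 3 + A ^ 2 / 3) ^ 2) in *.
  (* The decimals are upper bounds for 1/t0 and t0/3; q may be raised to Q because its net weight
     1/2 - t0/3 is positive. *)
  apply Rle_trans with ((1 - 9 * A / 4) * (2.3144 * A + Q / 2 + 0.14404 * (1 - A - Q))).
  - apply Rmult_le_compat_l; [lra|].
    assert (0 <= 1 - A - Q) by (unfold Q; nra).
    assert (0 <= (Q - q) * (1 / 2 - t0 / 3)) by (apply Rmult_le_pos; lra).
    assert (t0 / 3 * (1 - A - Q) <= 0.14404 * (1 - A - Q)) by (apply Rmult_le_compat_r; lra).
    nra.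
  - unfold Q.
    destruct (Rle_dec A 0.1); [|destruct (Rle_dec A 0.2)]; nra.
Qed.

(** A slack of at least A/5 lowers |c_1| enough to bring the first-order coefficient of the crude
    estimate below 9/8, the amount that the factor 1 - 9A/4 absorbs. *)
Lemma crude_small A q d :
  0 <= A <= 6 / 100 -> 2 * A / 10 <= d -> 0 <= 1 - 4 * A / 3 + A ^ 2 / 3 - d ->
  0 <= q <= (1 - 4 * A / 3 + A ^ 2 / 3 - d) ^ 2 ->
  (1 - 9 * A / 4) * (A / t0 + q / 2 + t0 / 3 * (1 - A - q)) <= 1 / 2.
Proof.
  intros HA Hd Hp Hq. pose proof t0_bounds as Ht.
  replace (A / t0) with (A * ((59 - 8 * t0) / 24)) by (rewrite <- t0_inv; reflexivity).
  assert (HQ : q <= (1 - 4 * A / 3 + A ^ 2 / 3 - A / 5) ^ 2).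
  { eapply Rle_trans; [apply Hq|]. apply pow_incr; lra. }
  set (Q := (1 - 4 * A / 3 + A ^ 2 / 3 - A / 5) ^ 2) in *.
  apply Rle_trans with ((1 - 9 * A / 4) * (2.3144 * A + Q / 2 + 0.14404 * (1 - A - Q))).
  - apply Rmult_le_compat_l; [lra|].
    assert (0 <= 1 - A - Q) by (unfold Q; nra).
    assert (0 <= (Q - q) * (1 / 2 - t0 / 3)) by (apply Rmult_le_pos; lra).
    assert (t0 / 3 * (1 - A - Q) <= 0.14404 * (1 - A - Q)) by (apply Rmult_le_compat_r; lra).
    nra.
  - unfold Q. nra.
Qed.

(** The remaining regime. [G] bounds |c_1|, [e] bounds 1 - |c_1|^2, [Sup] bounds |c_2|^2 and [Tup]
    bounds |c_k|^2 for k >= 3. The right-hand side is the Taylor polynomial of degree 2 of (1/2) /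
    (1 - 9A/4); the terms of first order in A agree on both sides, so the contest is at order
    A^2. *)
Lemma fine_polynomial A d :
  0 <= A <= 6 / 100 -> 0 <= d <= A / 5 ->
  let e := 8 * A / 3 + 2.06 * d in
  let Sup := (1 + A + 2 * d) * (A * (1 + 0.69 * A) + 2 * d) * (1 + 0.7 * A) in
  let Tup := 2 * (e - A) * e * (1 + 1.25 * e) in
  let G := 1 - 4 * A / 3 + A ^ 2 / 3 - d in
  A <= Sup /\
  A * 59 / 24 + G ^ 2 / 2 + 0.144034 * (Sup - A) + 0.0822 * Tup
    <= 1 / 2 + 9 / 8 * A + 81 / 32 * A ^ 2.
Proof.
  intros HA Hd e Sup Tup G. split.
  { unfold Sup. assert (H1 : A <= A * (1 + 0.69 * A) + 2 * d) by nra.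
    set (u := A * (1 + 0.69 * A) + 2 * d) in *. clearbody u.
    replace A with (1 * A * 1) at 1 by ring.
    apply Rmult_le_compat; [lra | lra | | lra].
    apply Rmult_le_compat; lra. }
  assert (F1 : G ^ 2 / 2 <= (1 - 4 * A / 3 + A ^ 2 / 3) ^ 2 / 2 - 0.91 * d).
  { unfold G. set (G0 := 1 - 4 * A / 3 + A ^ 2 / 3).
    assert (0.92 <= G0) by (unfold G0; nra). clearbody G0. nra. }
  assert (F2 : Sup <= (1 + A) * (A * (1 + 0.69 * A)) * (1 + 0.7 * A) + 2.4 * d).
  { unfold Sup. set (B := A * (1 + 0.69 * A)).
    assert (HB : 0 <= B <= 0.063) by (unfold B; nra). clearbody B.
    replace ((1 + A + 2 * d) * (B + 2 * d) * (1 + 0.7 * A)) with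
      ((1 + A) * B * (1 + 0.7 * A) + d * ((1 + 0.7 * A) * (2 * B + 2 * (1 + A) + 4 * d))) by ring.
    assert ((1 + 0.7 * A) * (2 * B + 2 * (1 + A) + 4 * d) <= 1.042 * 2.3)
      by (apply Rmult_le_compat; lra).
    nra. }
  assert (F3 : Tup <= 2 * (5 * A / 3) * (8 * A / 3) * (1 + 1.25 * (8 * A / 3)) + 2.1 * d).
  { set (e0 := 8 * A / 3). set (f := 2.06 * d).
    assert (He0 : 0 <= e0 - A /\ e0 <= 0.16) by (unfold e0; lra).
    replace (5 * A / 3) with (e0 - A) by (unfold e0; field).
    assert (Hf : 0 <= f <= 0.025) by (unfold f; lra).
    unfold Tup. change e with (e0 + f).
    apply Rle_trans with (2 * (e0 - A) * e0 * (1 + 1.25 * e0) + 1.01 * f); [|unfold f; lra].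
    clearbody e0 f.
    replace (2 * (e0 + f - A) * (e0 + f) * (1 + 1.25 * (e0 + f))) with
      (2 * (e0 - A) * e0 * (1 + 1.25 * e0) +
       f * (2 * (2 * e0 + f - A) * (1 + 1.25 * (e0 + f)) + 2.5 * (e0 - A) * e0)) by lra.
    assert (2 * (2 * e0 + f - A) * (1 + 1.25 * (e0 + f)) <= 2 * 0.345 * 1.24)
      by (apply Rmult_le_compat; lra).
    assert (2.5 * (e0 - A) * e0 <= 2.5 * 0.16 * 0.16) by (apply Rmult_le_compat; lra).
    nra. }
  apply Rle_trans with (A * 59 / 24 + (1 - 4 * A / 3 + A ^ 2 / 3) ^ 2 / 2
    + 0.144034 * ((1 + A) * (A * (1 + 0.69 * A)) * (1 + 0.7 * A) - A)
    + 0.0822 * (2 * (5 * A / 3) * (8 * A / 3) * (1 + 1.25 * (8 * A / 3)))); [lra|].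
  clear - HA. apply Rminus_le_0.
  replace (_ - _) with (A ^ 2 * (105353933 / 450000000 - 10173990569 / 4500000000 * A
    - 563057899 / 4500000000 * A ^ 2)) by lra.
  apply Rmult_le_pos; nra.
Qed.

Lemma fine_bound A g d S T :
  let m := 1 - A / 6 in
  0 <= A <= 6 / 100 -> 0 <= d <= A / 5 ->
  m ^ 2 * g = 1 - A * m ^ 4 - 2 * A * m / 3 - d ->
  m ^ 4 * S <= (1 + A + 2 * d) * (A * (1 + A / 3) ^ 2 + 2 * d) ->
  0 <= T -> g ^ 2 * T <= 2 * (1 - A - g ^ 2) * (1 - g ^ 2) ->
  (1 - 9 * A / 4) * (A / t0 + g ^ 2 / 2 + t0 / 3 * S + t0 ^ 2 / 4 / (1 - t0) * T) <= 1 / 2.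
Proof.
  intros m HA Hd Hg HS HT0 HT. pose proof t0_bounds as Ht.
  assert (Hm : 0.99 <= m <= 1) by (unfold m; lra).
  assert (HG : g <= 1 - 4 * A / 3 + A ^ 2 / 3 - d).
  { pose proof (first_coef_le A g ltac:(lra)) as H. cbv zeta in H. fold m in H.
    replace (1 - A * m ^ 4 - (m ^ 2 * g + 2 * A * m / 3)) with d in H by lra.
    apply H; lra. }
  (* A lower bound for g makes 1 - g^2 of order A, and with it the bound on the coefficients from
     c_3 on. *)
  assert (HL : 1 - 4 * A / 3 - 1.03 * d <= g).
  { apply Rmult_le_reg_l with (m ^ 2); [nra|]. rewrite Hg.
    apply Rminus_le_0.
    replace (_ - _) with (A ^ 2 * (7 / 9 - A / 6 + A ^ 2 / 54 - A ^ 3 / 1296 - 4 / 9 - 1 / 36 + A / 27)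
      + d * (1.03 * m ^ 2 - 1)) by (unfold m; field).
    assert (0 <= A ^ 2) by nra. assert (0 <= A ^ 3 <= 1) by nra.
    apply Rplus_le_le_0_compat; apply Rmult_le_pos; nra. }
  set (e := 8 * A / 3 + 2.06 * d).
  assert (He : 0 <= e <= 0.185) by (unfold e; lra).
  assert (Hq : 1 - e <= g ^ 2) by (unfold e; nra).
  assert (HT' : T <= 2 * (e - A) * e * (1 + 1.25 * e)).
  { assert (Hg1 : g <= 1) by nra.
    assert (Hq1 : g ^ 2 <= 1) by nra.
    assert (H0 : 0 <= e - A) by (unfold e; lra).
    assert (H1 : g ^ 2 * T <= 2 * ((e - A) * e)).
    { eapply Rle_trans; [exact HT|]. rewrite Rmult_assoc.
      apply Rmult_le_compat_l; [lra|].
      apply Rle_trans with ((e - A) * (1 - g ^ 2)).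
      - apply Rmult_le_compat_r; lra.
      - apply Rmult_le_compat_l; lra. }
    assert (H2 : (1 - e) * T <= 2 * ((e - A) * e)).
    { eapply Rle_trans; [|exact H1]. apply Rmult_le_compat_r; lra. }
    assert (H3 : 0 <= (e - A) * e) by nra.
    apply Rmult_le_reg_l with (1 - e); [lra|].
    eapply Rle_trans; [exact H2|].
    (* Valid for 0 <= e <= 1/5; it replaces division by 1 - e with a polynomial factor. *)
    assert (1 <= (1 - e) * (1 + 1.25 * e)) by nra. nra. }
  assert (HS' : S <= (1 + A + 2 * d) * (A * (1 + 0.69 * A) + 2 * d) * (1 + 0.7 * A)).
  { assert (Hm4 : 1 <= m ^ 4 * (1 + 0.7 * A)).
    { apply Rminus_le_0.
      replace (_ - _) with (A * ((0.7 - 2 / 3) - A * (0.7 * 2 / 3 - 1 / 6) + A ^ 2 * (0.7 / 6 - 1 / 54)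
        + A ^ 3 * (1 / 1296 - 0.7 / 54) + A ^ 4 * 0.7 / 1296)) by (unfold m; field).
      apply Rmult_le_pos; [lra|].
      assert (0 <= A ^ 2) by nra. assert (0 <= A ^ 3 <= 0.0036 * A) by nra.
      assert (0 <= A ^ 4) by nra. lra. }
    assert (Hm0 : 0 < m ^ 4) by (apply pow_lt; lra).
    apply Rmult_le_reg_l with (m ^ 4); [exact Hm0|].
    eapply Rle_trans; [exact HS|].
    set (U := (1 + A + 2 * d) * (A * (1 + 0.69 * A) + 2 * d)).
    assert (HU : (1 + A + 2 * d) * (A * (1 + A / 3) ^ 2 + 2 * d) <= U)
      by (apply Rmult_le_compat_l; nra).
    assert (0 <= U) by (unfold U; apply Rmult_le_pos; nra).
    nra. }
  assert (HW : t0 ^ 2 / 4 / (1 - t0) <= 0.0822).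
  { apply Rmult_le_reg_r with (1 - t0); [lra|]. unfold Rdiv at 1.
    rewrite Rmult_assoc, Rinv_l by lra. nra. }
  replace (A / t0) with (A * ((59 - 8 * t0) / 24)) by (rewrite <- t0_inv; reflexivity).
  (* This product telescopes to (1 - (9A/4)^3) / 2. *)
  apply Rle_trans with ((1 - 9 * A / 4) * (1 / 2 + 9 / 8 * A + 81 / 32 * A ^ 2)).
  2: { assert (0 <= A ^ 3) by (apply pow_le; lra). nra. }
  apply Rmult_le_compat_l; [lra|].
  set (Sup := (1 + A + 2 * d) * (A * (1 + 0.69 * A) + 2 * d) * (1 + 0.7 * A)) in *.
  set (Tup := 2 * (e - A) * e * (1 + 1.25 * e)) in *.
  set (G := 1 - 4 * A / 3 + A ^ 2 / 3 - d) in *.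
  destruct (fine_polynomial A d HA Hd) as [HA2 HN]. fold e Sup Tup G in HA2, HN.
  assert (E1 : g ^ 2 <= G ^ 2) by (apply pow_incr; nra).
  assert (E2 : t0 / 3 * S <= t0 / 3 * A + 0.144034 * (Sup - A)).
  { apply Rle_trans with (t0 / 3 * Sup); [apply Rmult_le_compat_l; lra|].
    assert (0 <= (0.144034 - t0 / 3) * (Sup - A)) by (apply Rmult_le_pos; lra). lra. }
  assert (E3 : t0 ^ 2 / 4 / (1 - t0) * T <= 0.0822 * Tup).
  { eapply Rle_trans; [apply Rmult_le_compat_r; [exact HT0|exact HW]|].
    apply Rmult_le_compat_l; lra. }
  lra.
Qed.

(** * Coefficient inequalities *)

(** Removes the error 1 + eps that truncation leaves in every Parseval estimate. *)
Lemma le_of_sqr_perturbation x B :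
  0 <= B -> (forall eps, 0 < eps -> x <= (1 + eps) ^ 2 * B) -> x <= B.
Proof.
  intros HB H. apply Rle_plus_epsilon. intros eta He.
  set (e := Rmin 1 (eta / (3 * B + 1))).
  assert (He0 : 0 < e) by (apply Rmin_glb_lt; [lra | apply Rdiv_lt_0_compat; lra]).
  assert (He1 : e <= 1) by apply Rmin_l.
  assert (He2 : e * (3 * B + 1) <= eta).
  { apply Rle_trans with (eta / (3 * B + 1) * (3 * B + 1)).
    - apply Rmult_le_compat_r; [lra | apply Rmin_r].
    - right; field; lra. }
  specialize (H e He0). nra.
Qed.

Lemma sqrt3_gt : 1.73 < sqrt 3.
Proof. rewrite <- (sqrt_Rsqr 1.73) by lra. apply sqrt_lt_1; unfold Rsqr; lra. Qed.

Lemma trunc_bound_circle c eps K :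
  disc_bounded c -> 0 < eps ->
  exists n, (K <= n)%nat /\
    forall v, Cmod v = 1 -> Cmod (peval (trunc c n) v) <= 1 + eps.
Proof.
  intros Hc He. pose proof sqrt3_gt.
  destruct (trunc_bound c 1 eps K Hc ltac:(lra) He) as [n [Hn H1]].
  exists n. split; [exact Hn|]. intros v Hv.
  specialize (H1 v ltac:(lra)). rewrite Hv in H1. lra.
Qed.

Lemma norm2_trunc c n : norm2 (trunc c n) = sum_f_R0 (fun k => Cmod (c k) ^ 2) n.
Proof.
  induction n as [|n IH].
  - cbn [trunc seq map norm2 sum_f_R0]. ring.
  - rewrite trunc_S, norm2_app, IH. cbn [norm2 sum_f_R0]. ring.
Qed.

Lemma norm2_trunc_le c m n :
  (m <= n)%nat -> norm2 (trunc c m) <= norm2 (trunc c n).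
Proof.
  induction 1 as [|n _ IH]; [lra|].
  rewrite trunc_S, norm2_app. pose proof (norm2_ge0 [c (S n)]); lra.
Qed.

Lemma sum_sqr_coef_le c n :
  disc_bounded c -> sum_f_R0 (fun k => Cmod (c k) ^ 2) n <= 1.
Proof.
  intros Hc. apply le_of_sqr_perturbation; [lra|]. intros eps He.
  destruct (trunc_bound_circle c eps n Hc He) as [m [Hm H]].
  rewrite <- norm2_trunc. apply Rle_trans with (norm2 (trunc c m)).
  - apply norm2_trunc_le; lia.
  - replace 1 with (norm2 [RtoC 1]) at 2 by (cbn [norm2]; rewrite Cmod_1; ring).
    apply norm2_le. intros v Hv. replace (peval [RtoC 1] v) with (RtoC 1) by (simpl; ring).
    rewrite Cmod_1, Rmult_1_r. auto.
Qed.

(** In the product of f(v) with 1 + x v^(p+1), the coefficients up to degree p are those of f; only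
    the next two are kept, and the others are dropped as nonnegative. *)
Lemma bessel_two_coef c p x :
  disc_bounded c ->
  sum_f_R0 (fun k => Cmod (c k) ^ 2) p
  + Cmod (c (S p) + x * c O)%C ^ 2 + Cmod (c (S (S p)) + x * c (S O))%C ^ 2
  <= 1 + Cmod x ^ 2.
Proof.
  intros Hc. apply le_of_sqr_perturbation; [pose proof (pow2_ge_0 (Cmod x)); lra|].
  intros eps He.
  destruct (trunc_bound_circle c eps (S (S p)) Hc He) as [m [Hm H]].
  replace m with (p + S (S (m - S (S p))))%nat in H by lia.
  set (e := (m - S (S p))%nat) in *. clearbody e. clear m Hm.
  set (r := map c (seq (S p) (S (S e)))).
  assert (E : trunc c (p + S (S e)) = trunc c p ++ r).
  { unfold trunc, r. rewrite <- map_app, <- seq_app. reflexivity. }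
  rewrite E in H.
  pose proof (bessel_two_term (trunc c p) r x _ ltac:(rewrite length_trunc; lia) H) as HB.
  rewrite <- norm2_trunc.
  eapply Rle_trans; [|exact HB]. rewrite Rplus_assoc. apply Rplus_le_compat_l.
  rewrite <- E.
  replace (trunc c (p + S (S e))) with (c 0%nat :: c 1%nat :: map c (seq 2 (p + S e)))
    by (rewrite (Nat.add_succ_r p (S e)); reflexivity).
  unfold r. cbn [seq map pscal padd norm2].
  set (l := padd _ _). pose proof (norm2_ge0 l). lra.
Qed.

Lemma unimodular_align (z : C) : exists u : C, Cmod u = 1 /\ (u * z)%C = RtoC (Cmod z).
Proof.
  destruct (Req_dec (Cmod z) 0) as [E|E].
  - exists (RtoC 1). split; [apply Cmod_1|]. rewrite (Cmod_eq_0 z E), Cmod_0. ring.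
  - assert (Es : RtoC (Cmod z) <> RtoC 0) by (intro K; apply E; exact (RtoC_inj _ _ K)).
    exists (Cconj z / RtoC (Cmod z))%C. split.
    + rewrite Cmod_div, Cmod_conj, Cmod_R, Rabs_pos_eq by (exact Es || apply Cmod_ge_0).
      field; exact E.
    + replace (Cconj z / Cmod z * z)%C with ((z * Cconj z) / Cmod z)%C by (field; exact Es).
      rewrite <- Cmod2_conj. replace (Cmod z ^ 2) with (Cmod z * Cmod z) by ring.
      rewrite RtoC_mult. field; exact Es.
Qed.

(** A unimodular x aligns c_k with x g. With u = |c_(k-1)|, s = |c_k| and y = 1 - a^2 - g^2,
    [bessel_two_coef] yields g s <= y + a u, while Parseval gives u^2 <= y; squaring produces 2 y (y
    + a^2) = 2 y (1 - g^2). *)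
Lemma tail_coef_bound c a g k :
  disc_bounded c -> 0 <= a -> 0 <= g -> c O = RtoC a -> c (S O) = RtoC g -> (3 <= k)%nat ->
  g ^ 2 * Cmod (c k) ^ 2 <= 2 * (1 - a ^ 2 - g ^ 2) * (1 - g ^ 2).
Proof.
  intros Hc Ha Hg H0 H1 Hk.
  destruct k as [|[|p]]; [lia|lia|].
  set (s := Cmod (c (S (S p)))). set (u := Cmod (c (S p))).
  assert (Hs : 0 <= s) by apply Cmod_ge_0. assert (Hu : 0 <= u) by apply Cmod_ge_0.
  assert (Hhead : a ^ 2 + g ^ 2 <= sum_f_R0 (fun k => Cmod (c k) ^ 2) p).
  { rewrite <- norm2_trunc. eapply Rle_trans; [|apply (norm2_trunc_le c 1 p); lia].
    cbn [trunc seq map norm2]. rewrite H0, H1, !Cmod_R, !pow2_abs. lra. }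
  assert (Hy : u ^ 2 <= 1 - a ^ 2 - g ^ 2).
  { pose proof (sum_sqr_coef_le c (S p) Hc) as HS. cbn [sum_f_R0] in HS. fold u in HS. lra. }
  assert (Hx : exists x, Cmod x = 1 /\ Cmod (c (S (S p)) + x * RtoC g)%C = s + g).
  { destruct (unimodular_align (c (S (S p)))) as [e [He1 He2]]. fold s in He2.
    exists (Cconj e). split; [rewrite Cmod_conj; exact He1|].
    assert (Ee : (e * Cconj e)%C = RtoC 1)
      by (rewrite <- Cmod2_conj, He1; f_equal; ring).
    replace (c (S (S p)) + Cconj e * g)%C with (Cconj e * RtoC (s + g))%C.
    - rewrite Cmod_mult, Cmod_conj, He1, Cmod_R, Rabs_pos_eq; lra.
    - rewrite RtoC_plus, <- He2.
      replace (Cconj e * (e * c (S (S p)) + g))%C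
        with ((e * Cconj e) * c (S (S p)) + Cconj e * g)%C by ring.
      rewrite Ee. ring. }
  destruct Hx as [x [Hx1 Hx2]].
  pose proof (bessel_two_coef c p x Hc) as HB.
  rewrite H0, H1, Hx2, Hx1 in HB.
  assert (Hlow : (u - a) ^ 2 <= Cmod (c (S p) + x * RtoC a)%C ^ 2).
  { set (z := (c (S p) + x * RtoC a)%C).
    assert (Hxa : Cmod (x * RtoC a)%C = a) by (rewrite Cmod_mult, Hx1, Cmod_R, Rabs_pos_eq; lra).
    assert (u <= Cmod z + a).
    { unfold u, z. replace (c (S p)) with ((c (S p) + x * a) + - (x * a))%C at 1 by ring.
      eapply Rle_trans; [apply Cmod_triangle|]. rewrite Cmod_opp, Hxa. lra. }
    assert (a <= Cmod z + u).
    { rewrite <- Hxa at 1. unfold u, z.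
      replace (x * a)%C with ((c (S p) + x * a) + - c (S p))%C at 1 by ring.
      eapply Rle_trans; [apply Cmod_triangle|]. rewrite Cmod_opp. lra. }
    rewrite <- !Rsqr_pow2. apply neg_pos_Rsqr_le; lra. }
  set (y := 1 - a ^ 2 - g ^ 2) in *.
  assert (Hgs : g * s <= y + a * u) by (unfold y; nra).
  replace (g ^ 2 * s ^ 2) with ((g * s) ^ 2) by ring.
  apply Rle_trans with ((y + a * u) ^ 2).
  - apply pow_incr; split; [apply Rmult_le_pos; lra | exact Hgs].
  - assert ((y + a * u) ^ 2 <= 2 * y ^ 2 + 2 * a ^ 2 * u ^ 2) by (pose proof (pow2_ge_0 (y - a * u)); lra).
    assert (a ^ 2 * u ^ 2 <= a ^ 2 * y) by (apply Rmult_le_compat_l; [nra | exact Hy]).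
    replace (2 * y * (1 - g ^ 2)) with (2 * y ^ 2 + 2 * (a ^ 2 * y)) by (unfold y; ring). lra.
Qed.

(* The determinant condition hidden in the quantified inequality: its first
   consequence is the Schwarz-Pick lemma, its second the bound on the second
   Schur parameter. *)
Lemma schur_parameters w0 w1 w2 :
  0 <= w0 < 1 -> 0 <= w1 ->
  (forall x : C, w0 ^ 2 + Cmod (RtoC w1 + x * RtoC w0)%C ^ 2 + Cmod (w2 + x * RtoC w1)%C ^ 2
                 <= 1 + Cmod x ^ 2) ->
  let P := 1 - w0 ^ 2 in
  w1 <= P /\
  Cmod (RtoC P * w2 + RtoC (w0 * w1 ^ 2))%C ^ 2 <= (P - w1 ^ 2) * (P ^ 2 - w1 ^ 2).
Proof.
  intros Hw0 Hw1 H P.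
  assert (HP : 0 < P) by (unfold P; nra).
  destruct w2 as [X Y].
  assert (Hxy : forall x1 x2 : R,
    w0 ^ 2 + ((w1 + x1 * w0) ^ 2 + (x2 * w0) ^ 2) + ((X + x1 * w1) ^ 2 + (Y + x2 * w1) ^ 2)
    <= 1 + (x1 ^ 2 + x2 ^ 2)).
  { intros x1 x2. specialize (H (x1, x2)). rewrite !Cmod_sqr in H.
    unfold Cplus, Cmult, RtoC in H. cbn [fst snd] in H.
    ring_simplify in H. ring_simplify. exact H. }
  clear H.
  set (D := P - w1 ^ 2).
  assert (Hw1P : w1 <= P).
  { assert (H : forall t, 0 <= D - 2 * t * (w0 * w1) + t ^ 2 * P).
    { intros t. pose proof (Hxy t 0) as K.
      pose proof (pow2_ge_0 (X + t * w1)). pose proof (pow2_ge_0 (Y + 0 * w1)).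
      unfold D, P. lra. }
    (* The minimiser of the quadratic in t. *)
    specialize (H (w0 * w1 / P)).
    replace (_ + _) with ((D * P - w0 ^ 2 * w1 ^ 2) / P) in H by (field; lra).
    replace (D * P - w0 ^ 2 * w1 ^ 2) with (P ^ 2 - w1 ^ 2) in H by (unfold D, P; ring).
    assert (0 <= P ^ 2 - w1 ^ 2).
    { replace (P ^ 2 - w1 ^ 2) with ((P ^ 2 - w1 ^ 2) / P * P) by (field; lra).
      apply Rmult_le_pos; lra. }
    nra. }
  split; [exact Hw1P|].
  set (S := (w0 + X) ^ 2 + Y ^ 2).
  assert (HS0 : 0 <= S) by (apply Rplus_le_le_0_compat; apply pow2_ge_0).
  (* The part linear in x is -2 w1 Re (conj(x) (w0 + w2)), so x is taken as a real multiple r of w0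
     + w2, with minimiser r = w1 / D. When D = 0 the quadratic becomes linear in r, and its slope
     must vanish. *)
  assert (Hdet : w1 ^ 2 * S <= (D - X ^ 2 - Y ^ 2) * D).
  { assert (Hr : forall r, 0 <= (D - X ^ 2 - Y ^ 2) - 2 * r * w1 * S + r ^ 2 * S * D).
    { intros r. pose proof (Hxy (r * (w0 + X)) (r * Y)) as K.
      unfold S, D, P. lra. }
    assert (HD : 0 <= D) by (unfold D; clear - Hw1P Hw0 Hw1 HP; assert (P <= 1) by (unfold P; nra); clearbody P; nra).
    destruct (Req_dec D 0) as [E|E].
    - assert (Hw : w1 * S <= 0).
      { destruct (Rle_dec (w1 * S) 0) as [|n]; [assumption|exfalso].
        pose proof (Hr (1 / (w1 * S))) as K. rewrite E in K.
        replace (2 * (1 / (w1 * S)) * w1 * S) with 2 in K by (field; split; intro; nra).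
        nra. }
      rewrite E. assert (0 <= w1 * S) by nra. nra.
    - pose proof (Hr (w1 / D)) as K.
      replace (_ + _) with (((D - X ^ 2 - Y ^ 2) * D - w1 ^ 2 * S) / D) in K by (field; exact E).
      assert (0 <= ((D - X ^ 2 - Y ^ 2) * D - w1 ^ 2 * S) / D * D) by (apply Rmult_le_pos; lra).
      replace (_ / D * D) with ((D - X ^ 2 - Y ^ 2) * D - w1 ^ 2 * S) in H by (field; exact E).
      lra. }
  rewrite Cmod_sqr. unfold Cplus, Cmult, RtoC. cbn [fst snd].
  (* After multiplication by P, the coefficient of |w2|^2 is P (w1^2 + D) = P^2; completing the
     square gives the disc for w2. *)
  assert (HPdet : P * (w1 ^ 2 * S) <= P * ((D - X ^ 2 - Y ^ 2) * D)) by (apply Rmult_le_compat_l; lra).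
  unfold S, D in *.
  assert (E0 : w0 ^ 2 = 1 - P) by (unfold P; ring).
  assert (E : (P * X - 0 * Y + w0 * w1 ^ 2) ^ 2 + (P * Y + 0 * X + 0) ^ 2
     = P ^ 2 * (X ^ 2 + Y ^ 2) + 2 * P * X * w0 * w1 ^ 2 + (1 - P) * w1 ^ 4)
    by (rewrite <- E0; ring).
  rewrite E.
  replace ((w0 + X) ^ 2) with (1 - P + 2 * w0 * X + X ^ 2) in HPdet by (rewrite <- E0; ring).
  nra.
Qed.

(** * Substitution of the non-centred curve *)

Definition pmul_lin (al be : C) (l : list C) : list C :=
  padd (pscal al l) (RtoC 0 :: pscal be l).

Lemma peval_pmul_lin al be l v : peval (pmul_lin al be l) v = ((al + be * v) * peval l v)%C.
Proof. unfold pmul_lin. rewrite peval_padd. cbn [peval]. rewrite !peval_pscal. ring. Qed.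

Fixpoint pcomp (be : C) (l : list C) : list C :=
  match l with
  | nil => nil
  | c :: l' => padd [c] (RtoC 0 :: pmul_lin (RtoC 1) be (pcomp be l'))
  end.

Lemma peval_pcomp be l v : peval (pcomp be l) v = peval l (v * (1 + be * v))%C.
Proof.
  induction l as [|c l IH]; [reflexivity|].
  cbn [pcomp]. rewrite peval_padd. cbn [peval]. rewrite peval_pmul_lin, IH. ring.
Qed.

Lemma peval_curve (m nu : C) c0 c1 c2 l :
  let be := (- (2) * m * nu)%C in
  exists l',
  forall v, peval ((m ^ 2 * c0)%C :: (m ^ 2 * c1 + 2 * m * nu * c0)%C
             :: (m ^ 2 * c2 + 2 * m * nu * (1 - m ^ 2) * c1 + nu ^ 2 * c0)%C :: l') v
   = (peval (c0 :: c1 :: c2 :: l) (v * (1 + be * v)) * (m + nu * v) ^ 2)%C.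
Proof.
  intros be.
  exists (padd [(m ^ 2 * 2 * be * c2 + 2 * m * nu * (c1 * be + c2) + nu ^ 2 * c1)%C;
                (m ^ 2 * be ^ 2 * c2 + 4 * m * nu * be * c2 + nu ^ 2 * (c1 * be + c2))%C;
                (2 * m * nu * be ^ 2 * c2 + 2 * nu ^ 2 * be * c2)%C;
                (nu ^ 2 * be ^ 2 * c2)%C]
    (pmul_lin m nu (pmul_lin m nu (pmul_lin (RtoC 1) be (pmul_lin (RtoC 1) be
       (pmul_lin (RtoC 1) be (pcomp be l))))))).
  intros v. cbn [peval]. rewrite peval_padd, !peval_pmul_lin, peval_pcomp. cbn [peval].
  unfold be. ring.
Qed.

(** For |v| = 1 both |m + nu v|^2 and (3 - |z|^2) / 2 contain the term 2 m nu Re v. It cancels, and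
    the comparison reduces to the hypothesis on m and nu, uniformly in v. *)
Lemma trunc_bound_curve c m nu eps K :
  disc_bounded c -> 0 <= m <= 1 -> 0 <= nu <= 2 / 9 ->
  m ^ 2 + nu ^ 2 + 2 * m ^ 2 * nu ^ 2 <= 1 -> 0 < eps ->
  exists n, (K <= n)%nat /\
    forall v, Cmod v = 1 ->
      Cmod (peval (trunc c n) (v * (1 + (- (2) * RtoC m * RtoC nu) * v))
             * (RtoC m + RtoC nu * v) ^ 2)%C <= 1 + eps.
Proof.
  intros Hc Hm Hnu Hmn He. pose proof sqrt3_gt.
  (* The curve stays in |z| <= 1 + 2 m nu <= 13/9 < sqrt 3; the error is halved because the factor
     |m + nu v|^2 is at most 2. *)
  destruct (trunc_bound c (13 / 9) (eps / 2) K Hc ltac:(lra) ltac:(lra)) as [n [Hn HB]].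
  exists n. split; [exact Hn|]. intros v Hv.
  set (z := (v * (1 + (- (2) * RtoC m * RtoC nu) * v))%C).
  assert (Hmn' : 0 <= m * nu <= 2 / 9) by nra.
  assert (Hz : Cmod z <= 13 / 9).
  { unfold z. rewrite Cmod_mult, Hv, Rmult_1_l.
    eapply Rle_trans; [apply Cmod_triangle|].
    rewrite Cmod_1, !Cmod_mult, Cmod_opp, !Cmod_R, Hv, !Rabs_pos_eq by lra. lra. }
  specialize (HB z Hz). rewrite Cmod_mult, Cmod_pow.
  set (s := Cmod (RtoC m + RtoC nu * v)%C ^ 2).
  assert (Hs : 0 <= s <= 2).
  { unfold s. split; [apply pow2_ge_0|].
    assert (Cmod (RtoC m + RtoC nu * v)%C <= 11 / 9).
    { eapply Rle_trans; [apply Cmod_triangle|].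
      rewrite Cmod_mult, !Cmod_R, Hv, !Rabs_pos_eq by lra. lra. }
    pose proof (Cmod_ge_0 (RtoC m + RtoC nu * v)%C). nra. }
  assert (Hsz : s <= (3 - Cmod z ^ 2) / 2).
  { assert (Hv2 : Cmod v ^ 2 = 1) by (rewrite Hv; ring).
    unfold s, z. rewrite Cmod_mult, Hv, Rmult_1_l, !Cmod_sqr.
    rewrite Cmod_sqr in Hv2. destruct v as [v1 v2].
    unfold Cplus, Cmult, Copp, RtoC in *. cbn [fst snd] in *.
    assert (E : v2 ^ 2 = 1 - v1 ^ 2) by lra.
    ring_simplify. ring_simplify in E. rewrite E. nra. }
  assert (Hd : 0 < 3 - Cmod z ^ 2) by (pose proof (Cmod_ge_0 z); nra).
  apply Rle_trans with ((2 / (3 - Cmod z ^ 2) + eps / 2) * s).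
  - apply Rmult_le_compat_r; lra.
  - assert (2 / (3 - Cmod z ^ 2) * s <= 1).
    { apply Rle_trans with (2 / (3 - Cmod z ^ 2) * ((3 - Cmod z ^ 2) / 2)).
      - apply Rmult_le_compat_l; [apply Rlt_le, Rdiv_lt_0_compat; lra | exact Hsz].
      - right; field; lra. }
    nra.
Qed.

Lemma curve_bessel c m nu x :
  disc_bounded c -> 0 <= m <= 1 -> 0 <= nu <= 2 / 9 ->
  m ^ 2 + nu ^ 2 + 2 * m ^ 2 * nu ^ 2 <= 1 ->
  let w0 := (RtoC m ^ 2 * c 0%nat)%C in
  let w1 := (RtoC m ^ 2 * c 1%nat + 2 * RtoC m * RtoC nu * c 0%nat)%C in
  let w2 := (RtoC m ^ 2 * c 2%nat + 2 * RtoC m * RtoC nu * (1 - RtoC m ^ 2) * c 1%nat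
             + RtoC nu ^ 2 * c 0%nat)%C in
  Cmod w0 ^ 2 + Cmod (w1 + x * w0)%C ^ 2 + Cmod (w2 + x * w1)%C ^ 2 <= 1 + Cmod x ^ 2.
Proof.
  intros Hc Hm Hnu Hmn w0 w1 w2.
  apply le_of_sqr_perturbation; [pose proof (pow2_ge_0 (Cmod x)); lra|].
  intros eps He.
  destruct (trunc_bound_curve c m nu eps 2 Hc Hm Hnu Hmn He) as [n [Hn H]].
  destruct n as [|[|n]]; [lia|lia|].
  change (trunc c (S (S n))) with (c 0%nat :: c 1%nat :: c 2%nat :: map c (seq 3 n)) in H.
  destruct (peval_curve (RtoC m) (RtoC nu) (c 0%nat) (c 1%nat) (c 2%nat) (map c (seq 3 n)))
    as [l' Hl'].
  fold w0 w1 w2 in Hl'.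
  assert (H' : forall v, Cmod v = 1 -> Cmod (peval ([w0] ++ w1 :: w2 :: l') v) <= 1 + eps).
  { intros v Hv. cbn [app]. rewrite Hl'. apply H, Hv. }
  pose proof (bessel_two_term [w0] (w1 :: w2 :: l') x _ (Nat.lt_0_succ 0) H') as HB.
  cbn [app pscal map padd norm2] in HB.
  set (l := padd _ _) in HB. pose proof (norm2_ge0 l). lra.
Qed.

(** [schur_parameters] applies to the first three coefficients of h. It gives d >= 0 and places w2
    within tau of -r, with tau^2 <= 2 d (A + 2 d); then m^2 c_2 = w2 - kap, where r <= a and kap <=
    a A / 3. *)
Lemma second_coef_bound c a g :
  disc_bounded c -> 0 <= a <= 2 / 3 -> 0 <= g <= 1 -> c 0%nat = RtoC a -> c 1%nat = RtoC g ->
  let A := a ^ 2 in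
  let m := 1 - A / 6 in
  let d := 1 - A * m ^ 4 - (m ^ 2 * g + 2 * A * m / 3) in
  0 <= d /\
  m ^ 4 * Cmod (c 2%nat) ^ 2 <= (1 + A + 2 * d) * (A * (1 + A / 3) ^ 2 + 2 * d).
Proof.
  intros Hc Ha Hg H0 H1 A m d.
  assert (HA : 0 <= A <= 4 / 9) by (unfold A; nra).
  assert (Hm : 25 / 27 <= m <= 1) by (unfold m; lra).
  set (nu := a / 3).
  assert (Hnu : 0 <= nu <= 2 / 9) by (unfold nu; lra).
  assert (HA9 : nu ^ 2 = A / 9) by (unfold nu, A; field).
  (* With nu^2 = A/9, the choice m = 1 - A/6 gives equality to first order in A, and the
     second-order term is negative. *)
  assert (Hmn : m ^ 2 + nu ^ 2 + 2 * m ^ 2 * nu ^ 2 <= 1).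
  { rewrite HA9. unfold m. clearbody A. nra. }
  set (w0 := a * m ^ 2). set (w1 := m ^ 2 * g + 2 * A * m / 3).
  set (kap := 2 * m * nu * (1 - m ^ 2) * g + nu ^ 2 * a).
  set (w2 := (RtoC (m ^ 2) * c 2%nat + RtoC kap)%C).
  assert (Hm2 : 0 <= m ^ 2 <= 1) by nra.
  assert (Hw0 : 0 <= w0 <= a) by (unfold w0; nra).
  assert (Hw1 : 0 <= w1).
  { unfold w1. apply Rplus_le_le_0_compat; [apply Rmult_le_pos; lra|].
    assert (0 <= A * m) by (apply Rmult_le_pos; lra). lra. }
  destruct (schur_parameters w0 w1 w2) as [HP HS]; [lra|exact Hw1| |].
  { intros x. pose proof (curve_bessel c m nu x Hc ltac:(lra) Hnu Hmn) as HB.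
    cbv zeta in HB. rewrite H0, H1 in HB.
    replace (RtoC m ^ 2 * RtoC a)%C with (RtoC w0) in HB
      by (unfold w0; rewrite !RtoC_mult, RtoC_pow; ring).
    replace (RtoC m ^ 2 * RtoC g + 2 * RtoC m * RtoC nu * RtoC a)%C with (RtoC w1) in HB.
    2: { rewrite <- !RtoC_pow, <- !RtoC_mult, <- RtoC_plus. f_equal.
         unfold w1, nu, A. field. }
    match type of HB with context [(?u + x * RtoC w1)%C] => replace u with w2 in HB end.
    2: { unfold w2, kap. rewrite !RtoC_plus, !RtoC_mult, !RtoC_pow, RtoC_minus, !RtoC_pow. ring. }
    rewrite Cmod_R, pow2_abs in HB. exact HB. }
  set (P := 1 - w0 ^ 2) in *.
  assert (Hd : d = P - w1) by (unfold d, P, w0, w1, A; ring).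
  split; [lra|].
  assert (HPr : 5 / 9 <= P <= 1) by (unfold P; nra).
  set (r := w0 * w1 ^ 2 / P).
  set (tau := Cmod (w2 + RtoC r)%C).
  assert (Htau0 : 0 <= tau) by apply Cmod_ge_0.
  assert (Htau : tau ^ 2 <= 2 * d * (A + 2 * d)).
  { replace (RtoC P * w2 + RtoC (w0 * w1 ^ 2))%C with (RtoC P * (w2 + RtoC r))%C in HS.
    2: { replace (w0 * w1 ^ 2) with (P * r) by (unfold r; field; lra).
         rewrite RtoC_mult. ring. }
    rewrite Cmod_mult, Cmod_R, Rabs_pos_eq in HS by lra. fold tau in HS.
    assert (Hw0A : w0 ^ 2 <= A) by (unfold A; nra).
    assert (HD : 0 <= P - w1 ^ 2 <= P * (A + 2 * d)).
    { split; [nra|]. replace w1 with (P - d) by lra.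
      apply Rle_trans with (P * (w0 ^ 2 + 2 * d)); [|apply Rmult_le_compat_l; lra].
      replace (w0 ^ 2) with (1 - P) by (unfold P; ring). nra. }
    assert (HE : 0 <= P ^ 2 - w1 ^ 2 <= P * (2 * d)) by (replace w1 with (P - d) by lra; nra).
    assert (K : (P * tau) ^ 2 <= P * (A + 2 * d) * (P * (2 * d))).
    { eapply Rle_trans; [exact HS|]. apply Rmult_le_compat; lra. }
    apply Rmult_le_reg_l with (P ^ 2); [apply pow_lt; lra|].
    replace (P ^ 2 * tau ^ 2) with ((P * tau) ^ 2) by ring.
    eapply Rle_trans; [exact K|]. right; ring. }
  assert (Hr : 0 <= r <= a).
  { assert (w1 ^ 2 / P <= 1).
    { apply Rmult_le_reg_r with P; [lra|]. unfold Rdiv. rewrite Rmult_assoc, Rinv_l by lra. nra. }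
    assert (0 <= w1 ^ 2 / P) by (apply Rdiv_le_0_compat; [apply pow2_ge_0 | lra]).
    replace r with (w0 * (w1 ^ 2 / P)) by (unfold r, Rdiv; ring). nra. }
  assert (Hk : 0 <= kap <= a * (A / 3)).
  { assert (Hmm : 0 <= 1 - m ^ 2 <= A / 3) by (unfold m; nra).
    assert (Hmmg : 0 <= (1 - m ^ 2) * g <= A / 3) by nra.
    assert (Hm3 : 0 <= m * ((1 - m ^ 2) * g) <= A / 3) by nra.
    unfold kap. rewrite HA9.
    replace (2 * m * nu * (1 - m ^ 2) * g + A / 9 * a) with
      (a * (2 / 3 * (m * ((1 - m ^ 2) * g)) + A / 9)) by (unfold nu; field).
    split; [apply Rmult_le_pos; lra | apply Rmult_le_compat_l; lra]. }
  set (s := Cmod (c 2%nat)).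
  assert (Hs : m ^ 2 * s <= a * (1 + A / 3) + tau).
  { replace (m ^ 2 * s) with (Cmod (RtoC (m ^ 2) * c 2%nat)%C)
      by (rewrite Cmod_mult, Cmod_R, Rabs_pos_eq by lra; reflexivity).
    replace (RtoC (m ^ 2) * c 2%nat)%C with ((w2 + RtoC r) + - RtoC (kap + r))%C
      by (unfold w2; rewrite RtoC_plus; ring).
    eapply Rle_trans; [apply Cmod_triangle|]. fold tau.
    rewrite Cmod_opp, Cmod_R, Rabs_pos_eq by lra. lra. }
  replace (m ^ 4 * s ^ 2) with ((m ^ 2 * s) ^ 2) by ring.
  apply Rle_trans with ((a * (1 + A / 3) + tau) ^ 2).
  { apply pow_incr. split; [apply Rmult_le_pos; [lra | apply Cmod_ge_0] | exact Hs]. }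
  replace (A * (1 + A / 3) ^ 2) with ((a * (1 + A / 3)) ^ 2) by (unfold A; ring).
  set (p := a * (1 + A / 3)). set (S := A + 2 * d) in *.
  assert (Hp : 0 <= p) by (unfold p; apply Rmult_le_pos; lra).
  assert (HS0 : 0 <= S) by (unfold S; lra).
  assert (Hd0 : 0 <= d) by lra.
  replace (1 + A + 2 * d) with (1 + S) by (unfold S; ring).
  clearbody p S d. clear - Hp HS0 Hd0 Htau Htau0.
  (* AM-GM: [2 p tau <= S p^2 + 2 d], because [tau^2 <= 2 d S]. *)
  assert (2 * p * tau <= S * p ^ 2 + 2 * d).
  { apply Rsqr_incr_0_var; [|nra]. rewrite !Rsqr_pow2.
    apply Rle_trans with (4 * p ^ 2 * (2 * d * S)).
    - replace ((2 * p * tau) ^ 2) with (4 * p ^ 2 * tau ^ 2) by ring.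
      apply Rmult_le_compat_l; [nra | exact Htau].
    - pose proof (pow2_ge_0 (S * p ^ 2 - 2 * d)). lra. }
  nra.
Qed.

(** * The area inequality *)

(** The quotient [t ^ k / t] encodes t^(k-1), including the exponent -1 at k = 0. *)
Definition area_sum (c : nat -> C) (t : R) (n : nat) : R :=
  sum_f_R0 (fun k => Cmod (c k) ^ 2 * (t ^ k / t) / INR (S k)) n.

Lemma pow_convex x y th k :
  0 <= x -> 0 <= y -> 0 <= th <= 1 ->
  (th * x + (1 - th) * y) ^ k <= th * x ^ k + (1 - th) * y ^ k.
Proof.
  intros Hx Hy Hth. induction k as [|k IH]; [simpl; lra|].
  rewrite <- !tech_pow_Rmult.
  apply Rle_trans with ((th * x + (1 - th) * y) * (th * x ^ k + (1 - th) * y ^ k)).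
  - apply Rmult_le_compat_l; [nra | exact IH].
  - assert (H : 0 <= (x - y) * (x ^ k - y ^ k)).
    { destruct (Rle_dec x y) as [Hxy|Hxy].
      - pose proof (pow_incr x y k ltac:(lra)). nra.
      - pose proof (pow_incr y x k ltac:(lra)). nra. }
    assert (0 <= th * (1 - th)) by nra. nra.
Qed.

(** Convexity of t^(k-1), compared with its chord over [t0, 1]; the case k = 0 is the convexity of
    1/t. *)
Lemma area_weight_convex t k :
  t0 <= t <= 1 ->
  let th := (1 - t) / (1 - t0) in
  t ^ k / t <= th * (t0 ^ k / t0) + (1 - th) * (1 ^ k / 1).
Proof.
  intros Ht th. pose proof t0_bounds as Hb.
  assert (Hth : 0 <= th <= 1).
  { unfold th. split; [apply Rdiv_le_0_compat; lra|].
    apply Rmult_le_reg_r with (1 - t0); [lra|]. unfold Rdiv.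
    rewrite Rmult_assoc, Rinv_l by lra. lra. }
  assert (E : t = th * t0 + (1 - th) * 1) by (unfold th; field; lra).
  destruct k as [|k].
  - rewrite !pow_O. apply Rmult_le_reg_r with (t * t0); [nra|].
    replace (1 / t * (t * t0)) with t0 by (field; lra).
    replace ((th * (1 / t0) + (1 - th) * (1 / 1)) * (t * t0)) with
      (t * (th + (1 - th) * t0)) by (field; lra).
    rewrite E. assert (0 <= th * (1 - th)) by nra. nra.
  - replace (t ^ S k / t) with (t ^ k) by (simpl; field; lra).
    replace (t0 ^ S k / t0) with (t0 ^ k) by (simpl; field; lra).
    rewrite E at 1. eapply Rle_trans; [apply pow_convex; lra|].
    rewrite !pow1. lra.
Qed.

Lemma area_sum_convex c t n :
  t0 <= t <= 1 ->
  let th := (1 - t) / (1 - t0) in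
  area_sum c t n <= th * area_sum c t0 n + (1 - th) * area_sum c 1 n.
Proof.
  intros Ht th. unfold area_sum. rewrite !scal_sum, <- plus_sum.
  apply sum_Rle. intros k _.
  pose proof (area_weight_convex t k Ht) as H. fold th in H. cbv zeta in H.
  assert (0 < / INR (S k)) by (apply Rinv_0_lt_compat, lt_0_INR; lia).
  unfold Rdiv at 1 3 5.
  replace (_ + _) with (Cmod (c k) ^ 2 * / INR (S k) *
    (th * (t0 ^ k / t0) + (1 - th) * (1 ^ k / 1))) by ring.
  replace (Cmod (c k) ^ 2 * (t ^ k / t) * / INR (S k)) with
    (Cmod (c k) ^ 2 * / INR (S k) * (t ^ k / t)) by ring.
  apply Rmult_le_compat_l; [|exact H].
  apply Rmult_le_pos; [apply pow2_ge_0 | lra].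
Qed.

Lemma area_sum_mono c t n : 0 < t -> area_sum c t n <= area_sum c t (S (S n)).
Proof.
  intros Ht. unfold area_sum. cbn [sum_f_R0].
  assert (H : forall k, 0 <= Cmod (c k) ^ 2 * (t ^ k / t) / INR (S k)).
  { intros k. apply Rdiv_le_0_compat; [|apply lt_0_INR; lia].
    apply Rmult_le_pos; [apply pow2_ge_0|]. apply Rdiv_le_0_compat; [apply pow_le; lra | lra]. }
  pose proof (H (S n)). pose proof (H (S (S n))). lra.
Qed.

Lemma area_weight_le t k x :
  0 < t <= 1 -> (2 <= k)%nat -> 0 <= x -> x * (t ^ k / t) / INR (S k) <= x * (t / 3).
Proof.
  intros Ht Hk Hx. destruct k as [|[|k]]; [lia|lia|].
  replace (t ^ S (S k) / t) with (t * t ^ k) by (simpl; field; lra).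
  assert (H1 : t ^ k <= 1) by (rewrite <- (pow1 k); apply pow_incr; lra).
  assert (H0 : 0 <= t ^ k) by (apply pow_le; lra).
  assert (H3 : 3 <= INR (S (S (S k)))) by (rewrite !S_INR; pose proof (pos_INR k); lra).
  unfold Rdiv. rewrite Rmult_assoc. apply Rmult_le_compat_l; [exact Hx|].
  apply Rmult_le_compat; [nra | apply Rlt_le, Rinv_0_lt_compat; lra | nra |].
  apply Rinv_le_contravar; lra.
Qed.

(** For k >= 2 the weight t^(k-1) / (k+1) is at most t/3. *)
Lemma area_sum_crude c t n :
  0 < t <= 1 ->
  area_sum c t (S (S n)) <= Cmod (c 0%nat) ^ 2 / t + Cmod (c 1%nat) ^ 2 / 2
   + t / 3 * (sum_f_R0 (fun k => Cmod (c k) ^ 2) (S (S n))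
              - Cmod (c 0%nat) ^ 2 - Cmod (c 1%nat) ^ 2).
Proof.
  intros Ht. induction n as [|n IH].
  - unfold area_sum. cbn [sum_f_R0].
    pose proof (area_weight_le t 2 (Cmod (c 2%nat) ^ 2) Ht (le_n 2) (pow2_ge_0 _)) as H.
    replace (Cmod (c 0%nat) ^ 2 * (t ^ 0 / t) / INR 1) with (Cmod (c 0%nat) ^ 2 / t)
      by (simpl; field; lra).
    replace (Cmod (c 1%nat) ^ 2 * (t ^ 1 / t) / INR 2) with (Cmod (c 1%nat) ^ 2 / 2)
      by (simpl; field; lra).
    lra.
  - unfold area_sum in *. cbn [sum_f_R0] in *.
    pose proof (area_weight_le t (S (S (S n))) (Cmod (c (S (S (S n)))) ^ 2) Ht ltac:(lia) (pow2_ge_0 _)).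
    lra.
Qed.

(** For k >= 3 the weight is at most t^(k-1) / 4, and these form a geometric series. *)
Lemma area_sum_fine c t T n :
  0 < t < 1 -> 0 <= T -> (forall k, (3 <= k)%nat -> Cmod (c k) ^ 2 <= T) ->
  area_sum c t (S (S n)) <= Cmod (c 0%nat) ^ 2 / t + Cmod (c 1%nat) ^ 2 / 2
   + t / 3 * Cmod (c 2%nat) ^ 2 + t ^ 2 / 4 / (1 - t) * T.
Proof.
  intros Ht HT0 HT.
  (* The factor 1 - t^n retains the exact finite geometric sum, as the induction requires. *)
  apply Rle_trans with (Cmod (c 0%nat) ^ 2 / t + Cmod (c 1%nat) ^ 2 / 2
   + t / 3 * Cmod (c 2%nat) ^ 2 + t ^ 2 / 4 / (1 - t) * T * (1 - t ^ n)).
  - induction n as [|n IH].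
    + unfold area_sum. cbn [sum_f_R0]. right. simpl. field. lra.
    + assert (E : area_sum c t (S (S (S n))) = area_sum c t (S (S n))
        + Cmod (c (S (S (S n)))) ^ 2 * (t ^ S (S (S n)) / t) / INR (S (S (S (S n))))) by reflexivity.
      rewrite E.
      assert (H : Cmod (c (S (S (S n)))) ^ 2 * (t ^ S (S (S n)) / t) / INR (S (S (S (S n))))
        <= T * (t ^ 2 * t ^ n) / 4).
      { replace (t ^ S (S (S n)) / t) with (t ^ 2 * t ^ n) by (simpl; field; lra).
        assert (0 <= t ^ 2 * t ^ n) by (apply Rmult_le_pos; apply pow_le; lra).
        apply Rmult_le_compat.
        - apply Rmult_le_pos; [apply pow2_ge_0 | assumption].
        - apply Rlt_le, Rinv_0_lt_compat, lt_0_INR; lia.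
        - apply Rmult_le_compat_r; [assumption | apply HT; lia].
        - apply Rinv_le_contravar; [lra|]. rewrite !S_INR. pose proof (pos_INR n). lra. }
      replace (t ^ 2 / 4 / (1 - t) * T * (1 - t ^ S n)) with
        (t ^ 2 / 4 / (1 - t) * T * (1 - t ^ n) + T * (t ^ 2 * t ^ n) / 4)
        by (simpl; field; lra).
      lra.
  - apply Rplus_le_compat_l.
    assert (0 <= t ^ 2 / 4 / (1 - t) * T).
    { apply Rmult_le_pos; [|exact HT0]. apply Rdiv_le_0_compat; [|lra]. nra. }
    assert (0 <= t ^ n) by (apply pow_le; lra). nra.
Qed.

Lemma zeroth_coef_le c a :
  disc_bounded c -> 0 <= a -> c 0%nat = RtoC a -> a <= 2 / 3.
Proof.
  intros Hc Ha H0. apply Rle_plus_epsilon. intros eps He.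
  pose proof sqrt3_gt.
  destruct (trunc_bound c 0 eps 0 Hc ltac:(lra) He) as [n [_ Hb]].
  specialize (Hb (RtoC 0) ltac:(rewrite Cmod_0; lra)).
  rewrite Cmod_0 in Hb.
  replace (peval (trunc c n) (RtoC 0)) with (RtoC a) in Hb.
  - rewrite Cmod_R, Rabs_pos_eq in Hb by exact Ha. lra.
  - unfold trunc. cbn [seq map peval]. rewrite H0. ring.
Qed.

Lemma area_bound_normalised c a g t n :
  disc_bounded c -> 0 <= a -> 0 <= g -> c 0%nat = RtoC a -> c 1%nat = RtoC g ->
  t0 <= t <= 1 ->
  (1 - 9 * a ^ 2 / 4) * area_sum c t n <= 1 / 2.
Proof.
  intros Hc Ha Hg H0 H1 Ht. pose proof t0_bounds as Hb.
  pose proof (zeroth_coef_le c a Hc Ha H0) as Ha2.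
  assert (M0 : Cmod (c 0%nat) = a) by (rewrite H0, Cmod_R, Rabs_pos_eq; lra).
  assert (M1 : Cmod (c 1%nat) = g) by (rewrite H1, Cmod_R, Rabs_pos_eq; lra).
  set (S1 := sum_f_R0 (fun k => Cmod (c k) ^ 2) (S (S n))).
  assert (HS1 : S1 <= 1) by (apply sum_sqr_coef_le, Hc).
  assert (Hg1 : g <= 1).
  { pose proof (sum_sqr_coef_le c 1 Hc) as K. cbn [sum_f_R0] in K. rewrite M0, M1 in K. nra. }
  pose proof (second_coef_bound c a g Hc ltac:(lra) ltac:(lra) H0 H1) as [Hd HC2].
  set (A := a ^ 2) in *. cbv zeta in Hd, HC2.
  set (m := 1 - A / 6) in *.
  set (d := 1 - A * m ^ 4 - (m ^ 2 * g + 2 * A * m / 3)) in *.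
  assert (HA : 0 <= A <= 4 / 9) by (unfold A; nra).
  assert (HB : 0 <= 1 - 9 * A / 4) by lra.
  pose proof (first_coef_le A g HA Hd) as HG. fold m in HG. fold d in HG.
  (* Endpoint t = 1: [first_coef_le] gives g <= (1 - A)(1 - A/3) <= 1 - A, and the crude bound
     suffices. *)
  assert (E1 : (1 - 9 * A / 4) * area_sum c 1 (S (S n)) <= 1 / 2).
  { apply Rle_trans with ((1 - 9 * A / 4) * (A / 1 + g ^ 2 / 2 + 1 / 3 * (1 - A - g ^ 2))).
    - apply Rmult_le_compat_l; [exact HB|].
      eapply Rle_trans; [apply area_sum_crude; lra|]. rewrite M0, M1. fold S1. fold A. lra.
    - assert (Hq : g ^ 2 <= (1 - A) ^ 2) by (apply pow_incr; nra).
      clearbody A. clear - Hq HA HB.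
      apply Rle_trans with ((1 - 9 * A / 4) * (A + (1 - A) ^ 2 / 6 + 1 / 3 * (1 - A))).
      + apply Rmult_le_compat_l; lra.
      + nra. }
  (* Endpoint t0, in three cases: A large, A small with slack d at least A/5, and A small with less
     slack. Only the last needs the bounds on c_2 and on the later coefficients. *)
  assert (E0 : (1 - 9 * A / 4) * area_sum c t0 (S (S n)) <= 1 / 2).
  { assert (Hcr : area_sum c t0 (S (S n)) <= A / t0 + g ^ 2 / 2 + t0 / 3 * (1 - A - g ^ 2)).
    { eapply Rle_trans; [apply area_sum_crude; lra|]. rewrite M0, M1. fold S1 A.
      apply Rplus_le_compat_l, Rmult_le_compat_l; lra. }
    destruct (Rle_dec (6 / 100) A) as [HA6|HA6].
    { eapply Rle_trans; [apply Rmult_le_compat_l; [exact HB | exact Hcr]|].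
      apply crude_large; [lra|]. split; [apply pow2_ge_0|]. apply pow_incr; lra. }
    destruct (Rle_dec (2 * A / 10) d) as [Hd5|Hd5].
    { eapply Rle_trans; [apply Rmult_le_compat_l; [exact HB | exact Hcr]|].
      apply crude_small with d; [lra | lra | lra |].
      split; [apply pow2_ge_0|]. apply pow_incr; lra. }
    assert (Hmg : m ^ 2 * g = 1 - A * m ^ 4 - 2 * A * m / 3 - d) by (unfold d; ring).
    (* Small A and d force g to be positive, so [T] may be defined by dividing by g^2. *)
    assert (Hg0 : 0 < g ^ 2).
    { apply pow_lt. apply Rmult_lt_reg_l with (m ^ 2); [unfold m; nra|].
      rewrite Hmg, Rmult_0_r.
      assert (0.9 <= m <= 1) by (unfold m; lra).
      assert (m ^ 4 <= 1) by (rewrite <- (pow1 4); apply pow_incr; lra).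
      clearbody m A d. nra. }
    set (T := 2 * (1 - A - g ^ 2) * (1 - g ^ 2) / g ^ 2).
    assert (Hgt : g ^ 2 * T = 2 * (1 - A - g ^ 2) * (1 - g ^ 2)) by (unfold T; field; nra).
    assert (HT : forall k, (3 <= k)%nat -> Cmod (c k) ^ 2 <= T).
    { intros k Hk. apply Rmult_le_reg_l with (g ^ 2); [exact Hg0|]. rewrite Hgt.
      exact (tail_coef_bound c a g k Hc Ha Hg H0 H1 Hk). }
    assert (HT0 : 0 <= T) by (eapply Rle_trans; [apply pow2_ge_0 | apply (HT 3%nat), le_n]).
    eapply Rle_trans.
    - apply Rmult_le_compat_l; [exact HB|].
      apply (area_sum_fine c t0 T n); [lra | exact HT0 | exact HT].
    - rewrite M0, M1. fold A.
      apply (fine_bound A g d); [lra | lra | exact Hmg | exact HC2 | exact HT0 | lra]. }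
  eapply Rle_trans; [apply Rmult_le_compat_l; [exact HB | apply area_sum_mono; lra]|].
  pose proof (area_sum_convex c t (S (S n)) Ht) as Hcv. cbv zeta in Hcv.
  set (th := (1 - t) / (1 - t0)) in *.
  assert (Hth : 0 <= th <= 1).
  { unfold th. split; [apply Rdiv_le_0_compat; lra|].
    apply Rmult_le_reg_r with (1 - t0); [lra|]. unfold Rdiv.
    rewrite Rmult_assoc, Rinv_l by lra. lra. }
  eapply Rle_trans; [apply Rmult_le_compat_l; [exact HB | exact Hcv]|].
  clearbody th. nra.
Qed.

(** * Rotation and return to Bloch functions *)

Lemma Cseries_cv_ext (f h : nat -> C) (l : C) :
  (forall k, f k = h k) -> Cseries_cv f l -> Cseries_cv h l.
Proof.
  intros E [H1 H2]. split.
  - apply Un_cv_ext with (2 := H1). intros n. apply sum_eq. intros k _. rewrite E; reflexivity.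
  - apply Un_cv_ext with (2 := H2). intros n. apply sum_eq. intros k _. rewrite E; reflexivity.
Qed.

Lemma Cseries_cv_mult (u : C) (f : nat -> C) (l : C) :
  Cseries_cv f l -> Cseries_cv (fun k => (u * f k)%C) (u * l)%C.
Proof.
  intros [H1 H2].
  assert (K : forall x, Un_cv (fun _ => x) x).
  { intros x eps He. exists O. intros n _. unfold Rdist. rewrite Rminus_diag, Rabs_R0. exact He. }
  split.
  - apply Un_cv_ext with (fun n => fst u * sum_f_R0 (fun k => fst (f k)) n
       - snd u * sum_f_R0 (fun k => snd (f k)) n).
    + intros n. rewrite !scal_sum, <- minus_sum. apply sum_eq. intros k _. simpl. ring.
    + apply CV_minus; apply CV_mult; auto.
  - apply Un_cv_ext with (fun n => fst u * sum_f_R0 (fun k => snd (f k)) n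
       + snd u * sum_f_R0 (fun k => fst (f k)) n).
    + intros n. rewrite !scal_sum, <- plus_sum. apply sum_eq. intros k _. simpl. ring.
    + apply CV_plus; apply CV_mult; auto.
Qed.

Lemma disc_bounded_rotate c u1 u2 :
  Cmod u1 = 1 -> Cmod u2 = 1 -> disc_bounded c ->
  disc_bounded (fun k => (u1 * u2 ^ k * c k)%C).
Proof.
  intros Hu1 Hu2 Hc z Hz.
  assert (E : Cmod (u2 * z)%C = Cmod z) by (rewrite Cmod_mult, Hu2; ring).
  destruct (Hc (u2 * z)%C) as [w [Hw1 Hw2]]; [rewrite E; exact Hz|].
  exists (u1 * w)%C. split.
  - apply Cseries_cv_ext with (2 := Cseries_cv_mult u1 _ _ Hw1).
    intros k. rewrite Cpow_mult_l. ring.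
  - rewrite Cmod_mult, Hu1, <- E. lra.
Qed.

(** Multiplying f by u1 makes c_0 nonnegative, and rotating the variable by u2 then does the same
    for c_1; no modulus changes. *)
Lemma area_bound c t n :
  disc_bounded c -> t0 <= t <= 1 ->
  (1 - 9 * Cmod (c 0%nat) ^ 2 / 4) * area_sum c t n <= 1 / 2.
Proof.
  intros Hc Ht.
  destruct (unimodular_align (c 0%nat)) as [u1 [Hu1 E1]].
  destruct (unimodular_align (u1 * c 1%nat)%C) as [u2 [Hu2 E2]].
  rewrite Cmod_mult, Hu1, Rmult_1_l in E2.
  set (c' := fun k => (u1 * u2 ^ k * c k)%C).
  assert (Hm : forall k, Cmod (c' k) = Cmod (c k)).
  { intros k. unfold c'. rewrite !Cmod_mult, Cmod_pow, Hu1, Hu2, pow1. ring. }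
  assert (E : area_sum c t n = area_sum c' t n).
  { unfold area_sum. apply sum_eq. intros k _. rewrite Hm. reflexivity. }
  rewrite E. apply (area_bound_normalised c' (Cmod (c 0%nat)) (Cmod (c 1%nat)) t n).
  - apply disc_bounded_rotate; assumption.
  - apply Cmod_ge_0.
  - apply Cmod_ge_0.
  - unfold c'. rewrite <- E1. simpl Cpow. ring.
  - unfold c'. rewrite <- E2. rewrite Cpow_1_r. ring.
  - exact Ht.
Qed.

Lemma Defs_Cpow (z : C) k : Defs.Cpow z k = (z ^ k)%C.
Proof. induction k as [|k IH]; [reflexivity|]. cbn [Defs.Cpow]. rewrite IH. reflexivity. Qed.

(* [f(z) = (2/3) F'(z / sqrt 3)], the factor [2/3] making [|f| <= 1] on the unit circle. *)
Definition rescaled_deriv (b : nat -> C) (k : nat) : C :=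
  (RtoC (2 / 3 * INR (S k) * (/ sqrt 3) ^ k) * b (S k))%C.

Lemma sqrt3_sqr : sqrt 3 ^ 2 = 3.
Proof. apply pow2_sqrt; lra. Qed.

Lemma disc_bounded_rescaled_deriv b : in_Bloch b -> disc_bounded (rescaled_deriv b).
Proof.
  intros [_ HB] z Hz. pose proof sqrt3_gt as H3.
  set (y := (RtoC (/ sqrt 3) * z)%C).
  assert (Hy : Cmod y = / sqrt 3 * Cmod z).
  { unfold y. rewrite Cmod_mult, Cmod_R, Rabs_pos_eq; [reflexivity|].
    apply Rlt_le, Rinv_0_lt_compat; lra. }
  assert (Hy1 : Cmod y < 1).
  { rewrite Hy. apply Rmult_lt_reg_l with (sqrt 3); [lra|].
    rewrite <- Rmult_assoc, Rinv_r by lra. lra. }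
  destruct (HB y Hy1) as [w [Hw1 Hw2]].
  change (Cmod w <= 1 / (1 - Cmod y ^ 2)) in Hw2.
  exists (RtoC (2 / 3) * w)%C. split.
  - apply Cseries_cv_ext with (2 := Cseries_cv_mult (RtoC (2 / 3)) _ _ Hw1).
    intros k. unfold deriv_terms. rewrite Defs_Cpow.
    change (Cscale ?a (Cmul ?u ?v)) with ((a * fst (u * v)%C, a * snd (u * v)%C) : C).
    replace ((INR (S k) * fst (b (S k) * y ^ k)%C, INR (S k) * snd (b (S k) * y ^ k)%C) : C)
      with (RtoC (INR (S k)) * (b (S k) * y ^ k))%C.
    2: { generalize ((b (S k) : C) * y ^ k)%C. generalize (INR (S k)). intros n [u1 u2]. unfold Cmult, RtoC. cbn [fst snd].
         f_equal; ring. }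
    unfold rescaled_deriv, y. rewrite Cpow_mult_l, !RtoC_mult, RtoC_pow. ring.
  - rewrite Cmod_mult, Cmod_R, Rabs_pos_eq by lra.
    assert (E : Cmod y ^ 2 = Cmod z ^ 2 / 3).
    { rewrite Hy, Rpow_mult_distr, pow_inv, sqrt3_sqr. field. }
    rewrite E in Hw2.
    assert (Hz2 : Cmod z ^ 2 < 3).
    { rewrite <- sqrt3_sqr. pose proof (Cmod_ge_0 z). nra. }
    replace (2 / (3 - Cmod z ^ 2)) with (2 / 3 * (1 / (1 - Cmod z ^ 2 / 3))) by (field; lra).
    apply Rmult_le_compat_l; lra.
Qed.

(** The term k = 0 vanishes, so n + 2 terms on the left match n + 1 on the right. The prefactor also
    turns the bound 1/2 into 27/8 r^4. *)
Lemma area_sum_rescaled_deriv b r n :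
  0 < r ->
  sum_f_R0 (fun k => INR k * Cnorm (b k) ^ 2 * r ^ (2 * k)) (S n)
  = 3 / 4 * (3 * r ^ 2) ^ 2 * area_sum (rescaled_deriv b) (3 * r ^ 2) n.
Proof.
  intros Hr. rewrite decomp_sum by lia. cbn [Nat.pred]. rewrite Rmult_0_l, Rmult_0_l, Rplus_0_l.
  unfold area_sum. rewrite scal_sum. apply sum_eq. intros k _.
  unfold rescaled_deriv. rewrite Cmod_mult, Cmod_R.
  change (Cnorm (b (S k))) with (Cmod (b (S k))).
  assert (HS : 0 < INR (S k)) by (apply lt_0_INR; lia).
  rewrite Rpow_mult_distr, pow2_abs, !Rpow_mult_distr.
  replace (((/ sqrt 3) ^ k) ^ 2) with (/ 3 ^ k).
  2: { rewrite <- pow_mult, Nat.mul_comm, pow_mult, pow_inv, sqrt3_sqr, pow_inv. reflexivity. }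
  replace (2 * S k)%nat with (2 + 2 * k)%nat by lia.
  rewrite pow_add, <- pow_mult.
  assert (0 < 3 ^ k) by (apply pow_lt; lra).
  field. lra.
Qed.

Lemma R_low_pos : 0 < R_low.
Proof.
  pose proof t0_bounds as Hb. unfold t0 in Hb. pose proof sqrt3_gt.
  unfold R_low. apply Rmult_lt_0_compat; [apply Rinv_0_lt_compat; lra | apply sqrt_lt_R0; lra].
Qed.

Lemma radius_range r : R_low <= r <= 1 / sqrt 3 -> t0 <= 3 * r ^ 2 <= 1.
Proof.
  intros [H1 H2]. pose proof R_low_pos. pose proof sqrt3_gt.
  assert (E1 : 3 * R_low ^ 2 = t0).
  { pose proof t0_bounds as Hb. unfold t0 in *. unfold R_low.
    rewrite Rpow_mult_distr, pow2_sqrt, pow_inv, Rpow_mult_distr, sqrt3_sqr by lra. field. }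
  assert (E2 : 3 * (1 / sqrt 3) ^ 2 = 1).
  { unfold Rdiv. rewrite Rpow_mult_distr, pow_inv, sqrt3_sqr. field. }
  rewrite <- E1. rewrite <- E2.
  split; apply Rmult_le_compat_l; try lra; apply pow_incr; lra.
Qed.

Lemma infinite_sum_shift f l :
  Un_cv (fun n => sum_f_R0 f (S n)) l -> infinite_sum f l.
Proof.
  intros H eps He. destruct (H eps He) as [N HN]. exists (S N). intros n Hn.
  destruct n as [|n]; [lia|]. apply HN. lia.
Qed.

Lemma bloch_area_bound b r :
  in_Bloch b -> R_low <= r <= 1 / sqrt 3 ->
  exists l : R,
    infinite_sum (fun k => INR k * Cnorm (b k) ^ 2 * r ^ (2 * k)) l /\
    (1 - Cnorm (b 1%nat) ^ 2) * l <= 27 / 8 * r ^ 4.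
Proof.
  intros Hb Hr. pose proof (radius_range r Hr) as Ht. pose proof t0_bounds as Ht0.
  assert (Hr0 : 0 < r) by (pose proof R_low_pos; lra).
  set (c := rescaled_deriv b). set (t := 3 * r ^ 2) in *.
  pose proof (disc_bounded_rescaled_deriv b Hb) as Hc. fold c in Hc.
  set (u := fun n => sum_f_R0 (fun k => INR k * Cnorm (b k) ^ 2 * r ^ (2 * k)) (S n)).
  assert (Hu : forall n, u n = 3 / 4 * t ^ 2 * area_sum c t n)
    by (intros n; apply area_sum_rescaled_deriv, Hr0).
  assert (Hgrow : Un_growing u).
  { intros n. unfold u. rewrite (tech5 _ (S n)).
    assert (0 <= INR (S (S n)) * Cnorm (b (S (S n))) ^ 2 * r ^ (2 * S (S n))); [|lra].
    apply Rmult_le_pos; [apply Rmult_le_pos|]; [apply pos_INR | apply pow2_ge_0 | apply pow_le; lra]. }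
  (* Convergence needs a separate bound, since the factor 1 - |b_1|^2 in the area inequality may
     vanish. All weights are at most 1/t, and Parseval bounds the rest. *)
  assert (Hbound : forall n, u n <= 3 / 4 * t ^ 2 * (1 / t)).
  { intros n. rewrite Hu. apply Rmult_le_compat_l; [nra|].
    apply Rle_trans with (sum_f_R0 (fun k => Cmod (c k) ^ 2) n * (1 / t)).
    - rewrite Rmult_comm, scal_sum. unfold area_sum. apply sum_Rle. intros k _.
      unfold Rdiv at 1. rewrite Rmult_assoc. apply Rmult_le_compat_l; [apply pow2_ge_0|].
      assert (Hk : 1 <= INR (S k)) by (rewrite S_INR; pose proof (pos_INR k); lra).
      assert (H1 : t ^ k <= 1) by (rewrite <- (pow1 k); apply pow_incr; lra).
      assert (H2 : 0 < / t) by (apply Rinv_0_lt_compat; lra).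
      assert (H3 : 0 <= t ^ k) by (apply pow_le; lra).
      assert (H4 : / INR (S k) <= 1) by (rewrite <- Rinv_1; apply Rinv_le_contravar; lra).
      assert (H5 : 0 < / INR (S k)) by (apply Rinv_0_lt_compat; lra).
      unfold Rdiv. rewrite <- (Rmult_1_r (1 * / t)).
      apply Rmult_le_compat; nra.
    - rewrite <- (Rmult_1_l (1 / t)) at 2. apply Rmult_le_compat_r.
      + apply Rdiv_le_0_compat; lra.
      + apply sum_sqr_coef_le, Hc. }
  destruct (growing_cv u Hgrow) as [l Hl].
  { exists (3 / 4 * t ^ 2 * (1 / t)). intros x [n ->]. apply Hbound. }
  exists l. split; [apply infinite_sum_shift; exact Hl|].
  assert (Hb1 : Cnorm (b 1%nat) ^ 2 = 9 * Cmod (c 0%nat) ^ 2 / 4).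
  { unfold c, rescaled_deriv. rewrite Cmod_mult, Cmod_R, Rpow_mult_distr, pow2_abs.
    change (Cnorm (b 1%nat)) with (Cmod (b 1%nat)). simpl INR. simpl (_ ^ 0). field. }
  apply (@Rle_cv_lim (fun n => (1 - Cnorm (b 1%nat) ^ 2) * u n) (fun _ => 27 / 8 * r ^ 4)).
  - intros n. rewrite Hu, Hb1.
    pose proof (area_bound c t n Hc Ht) as HA.
    replace (27 / 8 * r ^ 4) with (3 / 4 * t ^ 2 * (1 / 2)) by (unfold t; field).
    replace ((1 - 9 * Cmod (c 0%nat) ^ 2 / 4) * (3 / 4 * t ^ 2 * area_sum c t n)) with
      (3 / 4 * t ^ 2 * ((1 - 9 * Cmod (c 0%nat) ^ 2 / 4) * area_sum c t n)) by ring.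
    apply Rmult_le_compat_l; [nra | exact HA].
  - apply CV_mult; [|exact Hl]. intros eps He. exists O. intros n _.
    unfold Rdist. rewrite Rminus_diag, Rabs_R0. exact He.
  - intros eps He. exists O. intros n _. unfold Rdist. rewrite Rminus_diag, Rabs_R0. exact He.
Qed.

(** * The extremal function *)

Lemma sum_eventually_zero f N n :
  (forall k, (N < k)%nat -> f k = 0) -> (N <= n)%nat -> sum_f_R0 f n = sum_f_R0 f N.
Proof.
  intros Hf. induction 1 as [|n Hn IH]; [reflexivity|].
  rewrite tech5, IH, Hf by lia. ring.
Qed.

Lemma Un_cv_finite_sum f N :
  (forall k, (N < k)%nat -> f k = 0) -> Un_cv (sum_f_R0 f) (sum_f_R0 f N).
Proof.
  intros Hf eps He. exists N. intros n Hn.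
  rewrite (sum_eventually_zero f N n Hf Hn). unfold Rdist.
  rewrite Rminus_diag, Rabs_R0. exact He.
Qed.

Lemma Cseries_cv_finite (f : nat -> C) N :
  (forall k, (N < k)%nat -> f k = RtoC 0) ->
  Cseries_cv f (sum_f_R0 (fun k => fst (f k)) N, sum_f_R0 (fun k => snd (f k)) N).
Proof.
  intros Hf. split; cbn [fst snd];
    apply (Un_cv_finite_sum (fun k => _ (f k))); intros k Hk; rewrite Hf by exact Hk; reflexivity.
Qed.

Lemma b_ext_bloch : in_Bloch b_ext.
Proof.
  assert (Hz : forall k, (2 < k)%nat -> b_ext k = (0, 0)).
  { intros [|[|[|k]]] Hk; try lia; reflexivity. }
  split.
  - intros z _. eexists. apply (Cseries_cv_finite _ 2). intros k Hk.
    unfold ps_terms. rewrite Hz by exact Hk. unfold Cmul, RtoC. cbn [fst snd]. f_equal; ring.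
  - intros z Hn. change (Cnorm z) with (Cmod z) in *. eexists. split.
    + apply (Cseries_cv_finite _ 1). intros k Hk.
      unfold deriv_terms. rewrite Hz by lia. unfold Cscale, Cmul, RtoC. cbn [fst snd]. f_equal; ring.
    + match goal with |- Cnorm ?w <= _ => replace w with (RtoC (3 * sqrt 3 / 2) * z)%C end.
      2: { destruct z as [x y]. unfold deriv_terms, Cscale, Cmul, Cmult, RtoC, b_ext.
           simpl. f_equal; field. }
      change (Cmod (RtoC (3 * sqrt 3 / 2) * z)%C <= 1 / (1 - Cmod z ^ 2)).
      pose proof sqrt3_gt as H3. pose proof sqrt3_sqr as E3.
      rewrite Cmod_mult, Cmod_R, Rabs_pos_eq by lra.
      pose proof (Cmod_ge_0 z) as Hx. set (x := Cmod z) in *. set (s := sqrt 3) in *.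
      assert (Hx2 : 0 < 1 - x ^ 2) by nra.
      apply Rmult_le_reg_r with (1 - x ^ 2); [exact Hx2|].
      replace (1 / (1 - x ^ 2) * (1 - x ^ 2)) with 1 by (field; lra).
      (* Expanded with s^2 = 3, this is twice 1 - (3 s / 2) x (1 - x^2); the Bloch bound is attained
         where |z| = 1 / sqrt 3. *)
      assert (0 <= (s * x - 1) ^ 2 * (s * x + 2)).
      { apply Rmult_le_pos; [apply pow2_ge_0 | nra]. }
      replace ((s * x - 1) ^ 2 * (s * x + 2)) with (s ^ 2 * s * x ^ 3 - 3 * s * x + 2) in H by ring.
      rewrite E3 in H. lra.
Qed.

Lemma b_ext_equality r :
  exists l : R,
    infinite_sum (fun k => INR k * Cnorm (b_ext k) ^ 2 * r ^ (2 * k)) l /\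
    (1 - Cnorm (b_ext 1%nat) ^ 2) * l = 27 / 8 * r ^ 4.
Proof.
  assert (N0 : Cnorm (0, 0) = 0) by exact Cmod_0.
  eexists. split.
  - apply (Un_cv_finite_sum _ 2). intros [|[|[|k]]] Hk; try lia.
    cbn [b_ext]. rewrite N0. ring.
  - cbn [sum_f_R0 b_ext]. rewrite N0.
    assert (E : Cnorm (3 * sqrt 3 / 4, 0) ^ 2 = 27 / 16).
    { change (Cnorm ?w) with (Cmod w). rewrite Cmod_sqr. cbn [fst snd].
      replace ((3 * sqrt 3 / 4) ^ 2) with (9 / 16 * sqrt 3 ^ 2) by field. rewrite sqrt3_sqr. field. }
    rewrite E. simpl INR. simpl (2 * 2)%nat. field.
Qed.

Theorem theorem5 :
  (forall b : nat -> Cx, in_Bloch b ->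
     forall r : R, R_low <= r <= 1 / sqrt 3 ->
       exists l : R,
         infinite_sum (fun k => INR k * Cnorm (b k) ^ 2 * r ^ (2 * k)) l /\
         (1 - Cnorm (b 1%nat) ^ 2) * l <= 27 / 8 * r ^ 4) /\
  (in_Bloch b_ext /\
   forall r : R, R_low <= r <= 1 / sqrt 3 ->
     exists l : R,
       infinite_sum (fun k => INR k * Cnorm (b_ext k) ^ 2 * r ^ (2 * k)) l /\
       (1 - Cnorm (b_ext 1%nat) ^ 2) * l = 27 / 8 * r ^ 4).
Proof.
  split; [|split].
  - intros b Hb r Hr. exact (bloch_area_bound b r Hb Hr).
  - exact b_ext_bloch.
  - intros r _. exact (b_ext_equality r).
Qed.
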